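(* Let $X,Y$ be real Banach spaces, $Z$ a closed subspace of $Y$, and $T\in\mathcal{K}(X,Y)$ a multi-smooth operator of finite order. (A) If $Z$ is an $L^1$-predual space and an $M$-ideal in $Y$, then the following are equivalent: (a) $T\perp_B\mathcal{L}(X,Z)$; (b) there exists $x_0^{**}\in M_{T^{**}}$ such that $T^{**}x_0^{**}\perp_B Z^{\perp\perp}$; (c) $T^{**}\perp_B\mathcal{L}(X^{**},Z^{\perp\perp})$. (B) If $X^{**}$ has the $L^1$-property (and $Z$ is an arbitrary closed subspace of $Y$), then the following are equivalent: (a) $T\perp_B\mathcal{L}(X,Z)$; (b) there exists $x_0^{**}\in M_{T^{**}}\cap E_{X^{**}}$ such that $T^{**}x_0^{**}\perp_B Z^{\perp\perp}$; (c) $T^{**}\perp_B\mathcal{L}(X^{**},Z^{\perp\perp})$.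
   Context: All Banach spaces are real. $\mathcal{L}(X,Y)$ (respectively $\mathcal{K}(X,Y)$) is the space of bounded (respectively compact) linear operators with the operator norm; for a subspace $Z\subset Y$, $\mathcal{L}(X,Z)$ is regarded as a subspace of $\mathcal{L}(X,Y)$. $S_X$, $B_X$ are the unit sphere and closed unit ball of $X$; $E_X$ is the set of extreme points of $B_X$. For an operator $T$ on $X$, $M_T=\{x\in S_X:\|Tx\|=\|T\|\}$. Birkhoff-James orthogonality: $v\perp_B w$ means $\|v+\lambda w\|\ge\|v\|$ for all scalars $\lambda$; $v\perp_B W$ (for a subspace $W$) means $v\perp_B w$ for all $w\in W$. $Z^\perp=\{y^*\in Y^*:y^*(z)=0\ \forall z\in Z\}$ and $Z^{\perp\perp}\subset Y^{**}$ is the annihilator of $Z^\perp$; $T^{**}:X^{**}\to Y^{**}$ is the second adjoint, and $\mathcal{L}(X^{**},Z^{\perp\perp})$ is regarded as a subspace of $\mathcal{L}(X^{**},Y^{**})$. A non-zero $T\in\mathcal{L}(X,Y)$ is a multi-smooth operator of finite order if the linear span of $J(T)=\{f\in S_{\mathcal{L}(X,Y)^*}:f(T)=\|T\|\}$ is finite-dimensional. A Banach space $V$ is an $L^1$-predual space if $V^*$ is isometrically isomorphic to $L^1(\mu)$ for some positive measure $\mu$. A closed subspace $Z$ of $Y$ is an $M$-ideal in $Y$ if there is a linear projection $P:Y^*\to Y^*$ with $\ker P=Z^\perp$ and $\|y^*\|=\|Py^*\|+\|y^*-Py^*\|$ for all $y^*\in Y^*$. A Banach space $V$ has the $L^1$-property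 if for any $\{v_1,\dots,v_n\}\subseteq E_V$ with $v_i\neq\pm v_j$ for $1\le i\neq j\le n$, the set $\{v_1,\dots,v_n\}$ is linearly independent. *)

(* Defs.v *)
From HB Require Import structures.
From mathcomp Require Import all_boot all_order all_algebra.
From mathcomp Require Import all_classical all_reals all_analysis measurable_realfun.
Set Implicit Arguments.
Unset Strict Implicit.
Unset Printing Implicit Defensive.
Import Order.TTheory GRing.Theory Num.Theory.
Import numFieldNormedType.Exports.
Local Open Scope classical_set_scope.
Local Open Scope ring_scope.

Definition unit_ball {R : realType} (V : normedModType R) : set V :=
  [set x | `|x| <= 1].
Definition unit_sphere {R : realType} (V : normedModType R) : set V :=
  [set x | `|x| = 1].
Arguments unit_ball {R} V.
Arguments unit_sphere {R} V.

Section BoundedOperators.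
Context {R : realType} (X Y : normedModType R).

Definition bounded_linear : {pred X -> Y} :=
  mem [set f : X -> Y | linear f /\ exists M : R, forall x, `|f x| <= M * `|x|].

Record bop := Bop { bop_fun :> X -> Y; bop_funP : bop_fun \in bounded_linear }.

HB.instance Definition _ := [isSub for bop_fun].
HB.instance Definition _ := [Choice of bop by <:].

Lemma bounded_linear_submod : submod_closed bounded_linear.
Proof.
split.
  rewrite inE; split.
    by move=> a x y; rewrite [RHS](_ : _ = a *: 0 + 0 :> Y)// scaler0 addr0.
  by exists 0 => x; rewrite mul0r [X in `|X|](_ : _ = 0)// normr0.
move=> a f g /[!inE] -[lf [M fM]] [lg [N gN]]; split.
  move=> b x y; rewrite !fctE lf lg.
  rewrite !scalerDr !scalerA [b * a]mulrC -!addrA; congr (_ + _).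
  by rewrite addrCA.
exists (`|a| * M + N) => x; rewrite !fctE.
rewrite (le_trans (ler_normD _ _))// mulrDl lerD//.
by rewrite normrZ -mulrA ler_wpM2l.
Qed.

HB.instance Definition _ :=
  GRing.isSubmodClosed.Build _ _ bounded_linear bounded_linear_submod.
HB.instance Definition _ := [SubChoice_isSubLmodule of bop by <:].

Lemma bop_linear (f : bop) : linear f.
Proof. by have := bop_funP f; rewrite inE => -[]. Qed.

HB.instance Definition _ (f : bop) :=
  GRing.isLinear.Build R X Y _ (bop_fun f) (bop_linear f).

Definition opnorm (f : bop) : R := sup [set `|f x| | x in unit_ball X].

Lemma opnorm_has_sup (f : bop) : has_sup [set `|f x| | x in unit_ball X].
Proof.
split.
  by exists `|f 0|, 0 => //=; rewrite /unit_ball/= normr0.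
have := bop_funP f; rewrite inE => -[_ [M fM]].
exists `|M| => _ [x /= x1 <-].
rewrite (le_trans (fM x))// (le_trans (ler_wpM2r _ (ler_norm M)))//.
by rewrite ler_piMr.
Qed.

Lemma opnorm_ub (f : bop) x : `|x| <= 1 -> `|f x| <= opnorm f.
Proof.
move=> x1; apply: ub_le_sup; first by case: (opnorm_has_sup f).
by exists x.
Qed.

Lemma opnorm_le (f : bop) (M : R) :
  (forall x, `|x| <= 1 -> `|f x| <= M) -> opnorm f <= M.
Proof.
move=> fM; apply: ge_sup; first by case: (opnorm_has_sup f).
by move=> _ [x /= x1 <-]; exact: fM.
Qed.

Lemma opnorm_ge0 (f : bop) : 0 <= opnorm f.
Proof. by rewrite (le_trans _ (@opnorm_ub f 0 _)) ?normr0. Qed.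

Lemma le_opnorm (f : bop) x : `|f x| <= opnorm f * `|x|.
Proof.
have [->|x0] := eqVneq x 0; first by rewrite linear0 !normr0 mulr0.
rewrite -ler_pdivrMr ?normr_gt0//.
have := @opnorm_ub f (`|x|^-1 *: x).
rewrite linearZ/= !normrZ normfV normr_id mulVf ?normr_eq0// => /(_ (lexx _)).
by rewrite mulrC.
Qed.

Lemma opnormD (f g : bop) : opnorm (f + g) <= opnorm f + opnorm g.
Proof.
apply: opnorm_le => x x1.
by rewrite (le_trans (ler_normD _ _))// lerD// opnorm_ub.
Qed.

Let opnormZ_le a (f : bop) : opnorm (a *: f) <= `|a| * opnorm f.
Proof.
apply: opnorm_le => x x1.
by rewrite [X in `|X|](_ : _ = a *: f x)// normrZ ler_wpM2l// opnorm_ub.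
Qed.

Lemma opnormZ a (f : bop) : opnorm (a *: f) = `|a| * opnorm f.
Proof.
apply/eqP; rewrite eq_le opnormZ_le/=.
have [->|a0] := eqVneq a 0; first by rewrite normr0 mul0r opnorm_ge0.
rewrite -ler_pdivlMl ?normr_gt0// -normfV.
by rewrite (le_trans _ (opnormZ_le a^-1 _))// scalerA mulVf// scale1r.
Qed.

Lemma opnorm_eq0 (f : bop) : opnorm f = 0 -> f = 0.
Proof.
move=> f0; apply/val_inj/funext => x.
by apply/normr0_eq0/eqP; rewrite eq_le normr_ge0 (le_trans (le_opnorm f x))// f0 mul0r.
Qed.

HB.instance Definition _ :=
  @Lmodule_isNormed.Build R bop opnorm opnormD opnormZ opnorm_eq0.

End BoundedOperators.
Arguments bounded_linear {R} X Y _.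

Definition dual {R : realType} (V : normedModType R) : normedModType R :=
  bop V R^o.

Section Adjoint.
Context {R : realType} (X Y : normedModType R).

Lemma comp_bounded (T : bop X Y) (g : dual Y) : g \o T \in bounded_linear X R^o.
Proof.
rewrite inE; split; first by move=> a x y /=; rewrite !linearP.
exists (opnorm g * opnorm T) => x /=.
rewrite (le_trans (le_opnorm g _))// -mulrA ler_wpM2l ?opnorm_ge0//.
exact: le_opnorm.
Qed.

Definition adjoint_fun (T : bop X Y) (g : dual Y) : dual X :=
  Bop (comp_bounded T g).

Lemma adjoint_bounded (T : bop X Y) :
  adjoint_fun T \in bounded_linear (dual Y) (dual X).
Proof.
rewrite inE; split; first by move=> a g h; exact/val_inj/funext.
exists (opnorm T) => g; apply: opnorm_le => x x1 /=.
rewrite (le_trans (le_opnorm g _))// mulrC ler_wpM2r ?opnorm_ge0//.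
exact: opnorm_ub.
Qed.

Definition adjoint (T : bop X Y) : bop (dual Y) (dual X) :=
  Bop (adjoint_bounded T).

End Adjoint.

Section ClosedSubspaces.
Context {R : realType} (V : normedModType R).

Record closedSubspace := ClosedSubspace {
  csub_set :> set V;
  csub_submod : submod_closed (mem csub_set);
  csub_closed : closed csub_set }.

Variable Z : closedSubspace.

Definition csub_pred : {pred V} := mem (Z : set V).

HB.instance Definition _ :=
  GRing.isSubmodClosed.Build R V csub_pred (csub_submod Z).

Definition csub : Type := {z : V | z \in csub_pred}.

HB.instance Definition _ := SubChoice.on csub.
HB.instance Definition _ := [SubChoice_isSubLmodule of csub by <:].

Definition csub_norm (z : csub) : R := `|val z|.

Lemma csub_normD x y : csub_norm (x + y) <= csub_norm x + csub_norm y.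
Proof. by rewrite /csub_norm raddfD ler_normD. Qed.

Lemma csub_normZ a x : csub_norm (a *: x) = `|a| * csub_norm x.
Proof. by rewrite /csub_norm linearZ normrZ. Qed.

Lemma csub_norm_eq0 x : csub_norm x = 0 -> x = 0.
Proof. by move=> /normr0_eq0 x0; apply: val_inj; rewrite x0 raddf0. Qed.

HB.instance Definition _ :=
  @Lmodule_isNormed.Build R csub csub_norm csub_normD csub_normZ csub_norm_eq0.

End ClosedSubspaces.

Section L1.
Context d (T : measurableType d) {R : realType}.
Variable mu : {measure set T -> \bar R}.

(* LspaceType1 mu (integrable functions modulo a.e. equality) comes without
   algebraic structure; operations and norm are induced from LfunType through
   representatives. *)
Definition L1 : Type := LspaceType1 mu.
Local Notation Lfun1 := (LfunType mu (@lexx _ _ 1%E)).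

HB.instance Definition _ := gen_eqMixin L1.
HB.instance Definition _ := gen_choiceMixin L1.

Local Open Scope quotient_scope.

Lemma ae_eq_Lnorm1 (f g : T -> R) :
  measurable_fun setT f -> measurable_fun setT g -> f = g %[ae mu] ->
  ('N[mu]_1[EFin \o f] = 'N[mu]_1[EFin \o g])%E.
Proof.
move=> mf mg fg; rewrite !Lnorm1; apply: ae_eq_integral => //.
- by apply: measurableT_comp => //; exact/measurable_EFinP.
- by apply: measurableT_comp => //; exact/measurable_EFinP.
- by apply: filterS fg => x /= fg /fg ->.
Qed.

(* The same function, with the Borel structure of R carrying the display that
   LspaceType expects. *)
Definition L1_mfun (f : Lfun1) : {mfun T >-> measurableTypeR R} :=
  MeasurableFun.Pack (MeasurableFun.Class
    (isMeasurableFun.Build _ _ T (measurableTypeR R) f (@measurable_funPT _ _ _ _ f))).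

Definition L1_pi (f : Lfun1) : {mfun_ mu, T >-> measurableTypeR R} :=
  \pi_({mfun_ mu, T >-> measurableTypeR R}) (L1_mfun f).

Lemma L1_pi_ae (f : Lfun1) : (L1_pi f : T -> R) = f %[ae mu].
Proof.
apply/asboolP; rewrite -[`[< _ >]]/(ae_eq_op mu (repr _) (L1_mfun f)).
by rewrite -eqmodE reprK.
Qed.

Lemma L1_pi_finite (f : Lfun1) : finite_norm mu 1 (L1_pi f : T -> R).
Proof.
rewrite /finite_norm (ae_eq_Lnorm1 _ _ (L1_pi_ae f)).
- exact: Lfunction_finite.
- by move=> mT Y mY; exact: (measurable_funPT (repr (L1_pi f)) mT Y mY).
- exact: measurable_funPT.
Qed.

Definition L1_class (f : Lfun1) : L1 :=
  LebesgueSpace.Pack (LebesgueSpace.Class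
    (isFinLebesgue.Build _ _ _ _ _ (@lexx _ _ 1%E) _ (L1_pi_finite f))).

Lemma L1_repr_in (u : L1) : ((u : {mfun_ mu, T >-> measurableTypeR R}) : T -> R) \in Lfun mu 1.
Proof.
rewrite inE/=; apply/andP; split; rewrite inE/=.
  by move=> mT Y mY; exact: (measurable_funPT (repr (LebesgueSpace.sort u)) mT Y mY).
exact: Lebesgue_finite.
Qed.

Definition L1_repr (u : L1) : Lfun1 := Lfun_Sub (@lexx _ _ 1%E) (L1_repr_in u).

Lemma L1_inj (u v : L1) :
  (u : {mfun_ mu, T >-> measurableTypeR R}) = v -> u = v.
Proof.
case: u v => [u [[uF]]] [v [[vF]]] /= uv; rewrite uv in uF *.
by rewrite (Prop_irrelevance uF vF).
Qed.

Lemma L1_classP (f g : Lfun1) : L1_class f = L1_class g <-> f = g %[ae mu].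
Proof.
split=> [[] /eqmodP/asboolP//|fg]; apply: L1_inj; apply/eqmodP; exact/asboolP.
Qed.

Lemma L1_reprK u : L1_class (L1_repr u) = u.
Proof.
apply: L1_inj; rewrite /= -[RHS]reprK; apply/eqmodP/asboolP.
exact: aeW.
Qed.

Definition L1_add (u v : L1) : L1 := L1_class (L1_repr u + L1_repr v).
Definition L1_opp (u : L1) : L1 := L1_class (- L1_repr u).
Definition L1_scale (a : R) (u : L1) : L1 := L1_class (a *: L1_repr u).

Lemma L1_class_ind (P : L1 -> Prop) : (forall f, P (L1_class f)) -> forall u, P u.
Proof. by move=> Pf u; rewrite -(L1_reprK u). Qed.

Lemma L1_addE f g : L1_add (L1_class f) (L1_class g) = L1_class (f + g).
Proof.
apply/L1_classP; move: (L1_pi_ae f) (L1_pi_ae g).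
apply: filterS2 => x fx gx xT.
by rewrite [LHS](_ : _ = L1_pi f x + L1_pi g x)// fx// gx.
Qed.

Lemma L1_oppE f : L1_opp (L1_class f) = L1_class (- f).
Proof.
apply/L1_classP; move: (L1_pi_ae f); apply: filterS => x fx xT.
by rewrite [LHS](_ : _ = - L1_pi f x)// fx.
Qed.

Lemma L1_scaleE a f : L1_scale a (L1_class f) = L1_class (a *: f).
Proof.
apply/L1_classP; move: (L1_pi_ae f); apply: filterS => x fx xT.
by rewrite [LHS](_ : _ = a * L1_pi f x)// fx.
Qed.

Lemma L1_addA : associative L1_add.
Proof.
elim/L1_class_ind => f; elim/L1_class_ind => g; elim/L1_class_ind => h.
by rewrite !L1_addE addrA.
Qed.

Lemma L1_addC : commutative L1_add.
Proof.
by elim/L1_class_ind => f; elim/L1_class_ind => g; rewrite !L1_addE addrC.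
Qed.

Lemma L1_add0 : left_id (L1_class 0) L1_add.
Proof. by elim/L1_class_ind => f; rewrite L1_addE add0r. Qed.

Lemma L1_addN : left_inverse (L1_class 0) L1_opp L1_add.
Proof. by elim/L1_class_ind => f; rewrite L1_oppE L1_addE addNr. Qed.

HB.instance Definition _ :=
  GRing.isZmodule.Build L1 L1_addA L1_addC L1_add0 L1_addN.

Lemma L1_scaleA a b u : L1_scale a (L1_scale b u) = L1_scale (a * b) u.
Proof. by elim/L1_class_ind: u => f; rewrite !L1_scaleE scalerA. Qed.

Lemma L1_scale1 : left_id 1 L1_scale.
Proof. by elim/L1_class_ind => f; rewrite L1_scaleE scale1r. Qed.

Lemma L1_scaleDr : right_distributive L1_scale +%R.
Proof.
move=> a; elim/L1_class_ind => f; elim/L1_class_ind => g.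
by rewrite [_ + _]L1_addE !L1_scaleE [RHS]L1_addE scalerDr.
Qed.

Lemma L1_scaleDl u : {morph L1_scale^~ u : a b / a + b}.
Proof.
move=> a b; elim/L1_class_ind: u => f.
by rewrite !L1_scaleE [RHS]L1_addE scalerDl.
Qed.

HB.instance Definition _ := GRing.Zmodule_isLmodule.Build R L1
  L1_scaleA L1_scale1 L1_scaleDr L1_scaleDl.

Definition L1_norm (u : L1) : R := fine ('N[mu]_1[EFin \o L1_repr u])%E.

Lemma L1_normE f : L1_norm (L1_class f) = fine ('N[mu]_1[EFin \o f])%E.
Proof.
congr fine; apply: ae_eq_Lnorm1; last exact: L1_pi_ae.
- exact: measurable_funPT.
- exact: measurable_funPT.
Qed.

Lemma L1_normD u v : L1_norm (u + v) <= L1_norm u + L1_norm v.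
Proof.
elim/L1_class_ind: u => f; elim/L1_class_ind: v => g.
by rewrite [_ + _]L1_addE !L1_normE ler_LnormD.
Qed.

Lemma L1_normZ a u : L1_norm (a *: u) = `|a| * L1_norm u.
Proof.
elim/L1_class_ind: u => f; rewrite [_ *: _]L1_scaleE !L1_normE.
by rewrite [X in fine X]LnormZ -finite_norm_fine.
Qed.

Lemma L1_norm_eq0 u : L1_norm u = 0 -> u = 0.
Proof.
elim/L1_class_ind: u => f; rewrite L1_normE => /fine_Lnormr_eq0 f0.
exact/L1_classP.
Qed.

HB.instance Definition _ :=
  @Lmodule_isNormed.Build R L1 L1_norm L1_normD L1_normZ L1_norm_eq0.

End L1.

Section Notions.
Context {R : realType}.

Definition isometrically_isomorphic (V W : normedModType R) : Prop :=
  exists2 f : {linear V -> W}, bijective f & forall v, `|f v| = `|v|.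

(* Completeness is not part of L1_predual, M_ideal and L1_property: they are
   meant for closed subspaces and biduals of Banach spaces, which are complete. *)
Definition L1_predual (V : normedModType R) : Prop :=
  exists (d : measure_display) (T : measurableType d)
    (mu : {measure set T -> \bar R}),
    isometrically_isomorphic (dual V) (L1 mu).

Definition annihilator (V : normedModType R) (A : set V) : set (dual V) :=
  [set f | forall z, A z -> f z = 0].

Definition M_ideal (Y : normedModType R) (Z : closedSubspace Y) : Prop :=
  exists P : {linear dual Y -> dual Y},
    [/\ forall f, P (P f) = P f,
        [set f | P f = 0] = annihilator Z
      & forall f, `|f| = `|P f| + `|f - P f|].

Definition extreme_point (V : normedModType R) (A : set V) : set V :=
  [set x | A x /\ forall y z (t : R), A y -> A z -> 0 < t < 1 ->
    x = t *: y + (1 - t) *: z -> y = x /\ z = x].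

Definition L1_property (V : normedModType R) : Prop :=
  forall (n : nat) (v : 'I_n -> V),
    (forall i, extreme_point (unit_ball V) (v i)) ->
    (forall i j, i != j -> v i <> v j /\ v i <> - v j) ->
    forall a : 'I_n -> R, \sum_i a i *: v i = 0 -> forall i, a i = 0.

Definition BJ_orth (V : normedModType R) (v w : V) : Prop :=
  forall l : R, `|v + l *: w| >= `|v|.

Definition BJ_orth_set (V : normedModType R) (v : V) (W : set V) : Prop :=
  forall w, W w -> BJ_orth v w.

Definition norm_attaining (X Y : normedModType R) (T : bop X Y) : set X :=
  [set x | unit_sphere X x /\ `|T x| = `|T|].

(* L(X, W) as a subspace of L(X, Y), for a subspace W of Y. *)
Definition operators_into (X Y : normedModType R) (W : set Y) : set (bop X Y) :=
  [set S | forall x, W (S x)].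

Definition compact_operator (X Y : normedModType R) (T : bop X Y) : Prop :=
  compact (closure (T @` unit_ball X)).

Definition lin_span (V : lmodType R) (A : set V) : set V :=
  [set v | exists (n : nat) (a : 'I_n -> R) (b : 'I_n -> V),
    (forall i, A (b i)) /\ v = \sum_i a i *: b i].

Definition finite_dimensional (V : lmodType R) (W : set V) : Prop :=
  exists (n : nat) (e : 'I_n -> V), W = lin_span (range e).

Definition support_functionals (V : normedModType R) (v : V) : set (dual V) :=
  [set f | unit_sphere (dual V) f /\ f v = `|v|].

Definition multi_smooth_finite (X Y : normedModType R) (T : bop X Y) : Prop :=
  T <> 0 /\ finite_dimensional (lin_span (support_functionals T)).

End Notions.
Arguments operators_into {R} X {Y} W.

(* Main.v *)
Require Import Defs.
From HB Require Import structures.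
From mathcomp Require Import all_boot all_order all_algebra.
From mathcomp Require Import all_classical all_reals all_analysis.
From mathcomp Require Import measurable_realfun.
From mathcomp Require Import ring lra.
Set Implicit Arguments.
Unset Strict Implicit.
Unset Printing Implicit Defensive.
Import Order.TTheory GRing.Theory Num.Theory.
Import numFieldNormedType.Exports.
Local Open Scope classical_set_scope.
Local Open Scope ring_scope.

(** A point x that norms T^** and has T^** x orthogonal to the bipolar of Z makes
    T^** orthogonal to the operators into this bipolar, by evaluation at x
    (attaining_orth), and then T is orthogonal to the operators into Z, because
    S |-> S^** is an isometry (orth_adjoint2). To get such a point from the
    orthogonality of T, it is enough to find a norming pair of T, that is x in
    the ball of X^** and y in the ball of Y^* with x (T^* y) = |T|, such that y
    vanishes on Z: then y shows that T^** x is orthogonal to the bipolar of Z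
    (norming_pair_orth_bipolar).

    Every norming pair gives a norming functional tensor x y : S |-> x (S^* y) of
    T, so all these tensors lie in a space of finite dimension. Suppose that T is
    orthogonal to the operators into Z. For each finite-rank S into Z, almost
    norming pairs of T - e S converge weak-star, as e tends to 0, to a norming
    pair with x (S^* y) <= 0, because T is compact (norming_pair_orth). By
    convexity in finite dimension (zero_in_hull) some convex combination of
    norming tensors vanishes on all rank-one operators into Z
    (orth_convex_comb). The norming pairs with a fixed y, or with a fixed x, form
    a finite-dimensional face of a dual ball, so by Minkowski's theorem
    (minkowski) the left factors, or the right factors, of the combination may be
    taken extreme (norming_tensors_extreme_l, norming_tensors_extreme_r).

    It remains to use linear independence. If X^** has the L1-property, the
    combination is grouped by its extreme left factors, and each group yields a
    right factor that vanishes on Z (orth_extreme). If Z is an M-ideal, an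
    extreme right factor either vanishes on Z or restricts to an extreme point of
    the ball of the dual of Z; the second cannot happen for all of them when this
    dual is an L1-space, which has the L1-property (L1_has_L1_property), because
    the grouped left factors would be 0 (orth_M_ideal).

    Weak-star limits are pointwise limits along a free ultrafilter on nat. *)

(** * The Hahn-Banach theorem *)

Section HahnBanach.
Context {R : realType} {V : lmodType R}.

Definition sublinear (p : V -> R) : Prop :=
  (forall x y, p (x + y) <= p x + p y) /\
  (forall (a : R) x, 0 <= a -> p (a *: x) = a * p x).

Lemma sublinear0 p : sublinear p -> p 0 = 0.
Proof. by move=> [_ ph]; rewrite -(scale0r 0) ph// mul0r. Qed.

Lemma sublinear_geN p x : sublinear p -> - p (- x) <= p x.
Proof.
move=> sp; have [pD _] := sp.
by have := pD x (- x); rewrite subrr sublinear0//; lra.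
Qed.

(** The largest sublinear functional below p whose value at - a is at most
    - p a. *)
Definition lowered (p : V -> R) (a : V) (x : V) : R :=
  inf [set p (x + t *: a) - t * p a | t in [set t : R | 0 <= t]].

Section Lowered.
Context (p : V -> R) (a : V) (sp : sublinear p).

Lemma lowered_lb x :
  lbound [set p (x + t *: a) - t * p a | t in [set t : R | 0 <= t]] (- p (- x)).
Proof.
move=> _ [t /= t0 <-]; have [pD ph] := sp.
by have := pD (x + t *: a) (- x); rewrite addrAC subrr add0r ph//; lra.
Qed.

Lemma lowered_has_inf x :
  has_inf [set p (x + t *: a) - t * p a | t in [set t : R | 0 <= t]].
Proof.
by split; [exists (p (x + 0 *: a) - 0 * p a), 0 => /=|
  exists (- p (- x)); exact: lowered_lb].
Qed.

Lemma lowered_le x t : 0 <= t -> lowered p a x <= p (x + t *: a) - t * p a.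
Proof. by move=> t0; apply: ge_inf; [case: (lowered_has_inf x)|exists t]. Qed.

Lemma le_lowered x m : (forall t, 0 <= t -> m <= p (x + t *: a) - t * p a) ->
  m <= lowered p a x.
Proof.
move=> h; apply: lb_le_inf; first by case: (lowered_has_inf x).
by move=> _ [t /= t0 <-]; exact: h.
Qed.

Lemma lowered_lep x : lowered p a x <= p x.
Proof. by rewrite (le_trans (lowered_le x (lexx 0)))// scale0r addr0 mul0r subr0. Qed.

Lemma lowered_opp : lowered p a (- a) <= - p a.
Proof.
rewrite (le_trans (lowered_le (- a) ler01))// scale1r addNr sublinear0//.
by rewrite mul1r add0r.
Qed.

Lemma lowered_sublinear : sublinear (lowered p a).
Proof.
have [pD ph] := sp.
have hom b x : 0 < b -> b * lowered p a x <= lowered p a (b *: x).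
  move=> b0; apply: le_lowered => t t0.
  rewrite -ler_pdivlMl// (le_trans (@lowered_le x (b^-1 * t) _))//.
    by rewrite mulr_ge0// invr_ge0 ltW.
  have -> : b *: x + t *: a = b *: (x + (b^-1 * t) *: a).
    by rewrite scalerDr scalerA mulrA divff ?gt_eqF// mul1r.
  by rewrite (ph _ _ (ltW b0)) mulrBr mulKf ?gt_eqF// mulrA.
split=> [x y|b x].
  rewrite -lerBlDr; apply: le_lowered => t t0; rewrite lerBlDl -lerBlDr.
  apply: le_lowered => s s0; rewrite lerBlDl.
  rewrite (le_trans (@lowered_le _ (t + s) _)) ?addr_ge0//.
  by have := pD (x + t *: a) (y + s *: a); rewrite scalerDl addrACA; lra.
rewrite le_eqVlt => /predU1P[<-|b0].
  rewrite scale0r mul0r; apply/eqP; rewrite eq_le; apply/andP; split.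
    by rewrite -[leRHS](sublinear0 sp) lowered_lep.
  by apply: le_lowered => t t0; rewrite add0r ph// subrr.
apply/eqP; rewrite eq_le hom// andbT.
rewrite -ler_pdivrMl// -[in leRHS](scale1r x) -(mulVf (lt0r_neq0 b0)) -scalerA.
by rewrite hom// invr_gt0.
Qed.

End Lowered.

Section Minimal.
Context (p : V -> R) (sp : sublinear p).

Let below := {q : V -> R | sublinear q /\ forall x, q x <= p x}.
Let ge_fun (q r : below) := `[< forall x, sval r x <= sval q x >].

(** By Zorn's lemma: the pointwise infimum of a chain is sublinear, and it is
    finite because every sublinear q below p satisfies q x >= - p (- x). *)
Lemma minimal_sublinear : exists q, [/\ sublinear q, forall x, q x <= p x &
  forall r, sublinear r -> (forall x, r x <= q x) -> r = q].
Proof.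
suff [[q [sq qp]] qmin] : exists q, forall r, ge_fun q r -> r = q.
  exists q; split=> // r sr rq.
  have rp x : r x <= p x by exact: le_trans (rq x) (qp x).
  by have /(congr1 sval) := qmin (exist _ r (conj sr rp)) (asboolT rq).
apply: Zorn => [q|q r s /asboolP rq /asboolP sr|
  [q qP] [r rP] /asboolP/= rq /asboolP/= qr|A Atot].
- by apply/asboolP.
- by apply/asboolP => x; exact: le_trans (sr x) (rq x).
- have qr' : q = r by apply/funext => x; apply/eqP; rewrite eq_le qr rq.
  by subst r; congr exist; exact: Prop_irrelevance.
have [->|/set0P[q0 Aq0]] := eqVneq A set0.
  by exists (exist _ p (conj sp (fun x => lexx (p x)))).
pose S x := [set sval q x | q in A].
have Slb x : lbound (S x) (- p (- x)).
  move=> _ [[q [sq qp]] /= _ <-]; apply: le_trans (sublinear_geN x sq).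
  by rewrite lerN2.
have Sinf x : has_inf (S x).
  by split; [exists (sval q0 x), q0 | exists (- p (- x)); exact: Slb].
pose m x := inf (S x).
have mq q x : A q -> m x <= sval q x.
  by move=> Aq; apply: ge_inf; [case: (Sinf x)|exists q].
have mle x c : (forall q, A q -> c <= sval q x) -> c <= m x.
  move=> h; apply: lb_le_inf; first by case: (Sinf x).
  by move=> _ [q Aq <-]; exact: h.
have sm : sublinear m.
  split=> [x y|b x b0].
    rewrite -lerBlDr; apply: (mle _ _) => q Aq; rewrite lerBlDl -lerBlDr.
    apply: (mle y) => r Ar; rewrite lerBlDl.
    have [s [As sq sr]] : exists s, [/\ A s, sval s x <= sval q x & sval s y <= sval r y].
      have [/asboolP h|/asboolP h] := Atot _ _ Aq Ar; first by exists r.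
      by exists q.
    apply: le_trans (mq _ _ As) _; have [[sD _] _] := svalP s.
    by rewrite (le_trans (sD x y))// lerD.
  apply/eqP; rewrite eq_le; apply/andP; split.
    move: b0; rewrite [0 <= b]le_eqVlt => /predU1P[<-|b0].
      rewrite scale0r mul0r (le_trans (mq _ _ Aq0))//.
      by rewrite sublinear0//; case: (svalP q0).
    rewrite -ler_pdivrMl//; apply: (mle _ _) => q Aq; rewrite ler_pdivrMl//.
    by have [[_ qh] _] := svalP q; rewrite -(qh _ _ (ltW b0)) mq.
  apply: (mle _ _) => q Aq; have [[_ qh] _] := svalP q.
  by rewrite qh// ler_wpM2l// mq.
have mp x : m x <= p x.
  by apply: le_trans (mq _ _ Aq0) _; case: (svalP q0).
exists (exist _ m (conj sm mp)) => q Aq; apply/asboolP => x /=.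
exact: mq.
Qed.

(** A minimal sublinear functional below p equals each of its lowered versions,
    so it is odd, and an odd sublinear functional is linear. *)
Lemma hahn_banach : exists f : {linear V -> R^o}, forall x, f x <= p x.
Proof.
have [q [sq qp qmin]] := minimal_sublinear; have [qD qh] := sq.
have qN x : q (- x) = - q x.
  apply/eqP; rewrite eq_le; apply/andP; split; last first.
    by have := sublinear_geN x sq; rewrite lerNl.
  have := lowered_opp x sq.
  by rewrite (qmin _ (lowered_sublinear x sq))//; exact: lowered_lep.
have qZ a x : q (a *: x) = a * q x.
  have [a0|a0] := leP 0 a; first exact: qh.
  by rewrite -[a]opprK scaleNr qN qh ?mulNr// oppr_ge0 ltW.
have qA x y : q (x + y) = q x + q y.
  apply/eqP; rewrite eq_le qD/=.
  by have := qD (- x) (- y); rewrite -opprD !qN; lra.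
have ql : linear (q : V -> R^o) by move=> a x y; rewrite qA qZ.
pose L := GRing.isLinear.Build R V R^o _ (q : V -> R^o) ql.
by exists (HB.pack_for {linear V -> R^o} (q : V -> R^o) L).
Qed.

End Minimal.

End HahnBanach.

Section NormedHahnBanach.
Context {R : realType}.

Lemma bounded_linearP (V W : normedModType R) (f : {linear V -> W}) (M : R) :
  (forall x, `|f x| <= M * `|x|) -> (f : V -> W) \in bounded_linear V W.
Proof. by move=> fM; rewrite inE; split; [exact: linearP|exists M]. Qed.

Lemma opnorm_leM (V W : normedModType R) (f : bop V W) (M : R) :
  0 <= M -> (forall x, `|f x| <= M * `|x|) -> `|f| <= M.
Proof.
move=> M0 fM; apply: opnorm_le => x x1; rewrite (le_trans (fM x))//.
exact: ler_piMr.
Qed.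

Lemma dual_of_le (V : normedModType R) (f : {linear V -> R^o}) (M : R) :
  0 <= M -> (forall x, f x <= M * `|x|) ->
  exists g : dual V, `|g| <= M /\ forall x, g x = f x.
Proof.
move=> M0 fM; have fM' x : `|f x| <= M * `|x|.
  rewrite -[leLHS]/(`|f x : R|) ler_norml fM andbT.
  by have := fM (- x); rewrite linearN normrN lerNl.
by exists (Bop (bounded_linearP fM')); split=> //; exact: opnorm_leM.
Qed.

(** A linear functional below the norm lowered at x is at most - |x| at - x. *)
Lemma norming_functional (V : normedModType R) (x : V) :
  exists g : dual V, `|g| <= 1 /\ g x = `|x|.
Proof.
have sn : sublinear (fun v : V => `|v|).
  by split=> [u v|a v a0]; [exact: ler_normD|rewrite normrZ ger0_norm].
have [f fle] := hahn_banach (lowered_sublinear x sn).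
have f1 v : f v <= 1 * `|v| by rewrite mul1r (le_trans (fle v))// lowered_lep.
have [g [g1 gf]] := dual_of_le ler01 f1; exists g; split=> //.
apply/eqP; rewrite eq_le gf -{1}[`|x|]mul1r f1/=.
by have := le_trans (fle _) (lowered_opp x sn); rewrite linearN lerN2.
Qed.

(** The infimal convolution p of f on Z with |f| times the norm is sublinear, at
    most f on Z and at most |f| times the norm. A linear functional below p is
    at most f on Z, hence equal to f there by oddness. *)
Lemma dual_extension (V : normedModType R) (Z : closedSubspace V)
    (f : dual (csub Z)) :
  exists g : dual V, `|g| <= `|f| /\ forall z : csub Z, g (val z) = f z.
Proof.
pose S y := [set f z + `|f| * `|y - val z| | z in [set: csub Z]].
pose p y := inf (S y).
have Slb y : lbound (S y) (- (`|f| * `|y|)).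
  move=> _ [z _ <-].
  have := le_trans (ler_norm _) (le_opnorm f (- z)); rewrite linearN normrN.
  have : `|f| * `|z| <= `|f| * `|y| + `|f| * `|y - val z|.
    rewrite -mulrDr ler_wpM2l// -[`|z|]/`|val z| -[X in `|X|](subKr y).
    exact: ler_normB.
  rewrite -[opnorm f]/`|f|; lra.
have Sinf y : has_inf (S y).
  by split; [exists (f 0 + `|f| * `|y - val (0 : csub Z)|), 0|
    exists (- (`|f| * `|y|)); exact: Slb].
have ple y z : p y <= f z + `|f| * `|y - val z|.
  by apply: ge_inf; [case: (Sinf y)|exists z].
have lep y c : (forall z, c <= f z + `|f| * `|y - val z|) -> c <= p y.
  by move=> h; apply: lb_le_inf; [case: (Sinf y)|move=> _ [z _ <-]].
have v0 : val (0 : csub Z) = 0 by exact: linear0.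
have sp : sublinear p.
  have hom b y : 0 < b -> b * p y <= p (b *: y).
    move=> b0; apply: (lep _ _) => z; rewrite -ler_pdivlMl//.
    rewrite (le_trans (ple y (b^-1 *: z)))// linearZ/= mulrDr lerD//.
    rewrite mulrCA ler_wpM2l//.
    have -> : y - val (b^-1 *: z) = b^-1 *: (b *: y - val z).
      have -> : val (b^-1 *: z) = b^-1 *: val z by exact: linearZ.
      by rewrite scalerBr scalerA mulVf ?gt_eqF// scale1r.
    by rewrite normrZ gtr0_norm ?invr_gt0.
  split=> [x y|b y].
    rewrite -lerBlDr; apply: (lep _ _) => z; rewrite lerBlDl -lerBlDr.
    apply: lep => w; rewrite lerBlDl (le_trans (ple _ (z + w)))//.
    have : `|f| * `|x + y - val (z + w)| <=
           `|f| * `|x - val z| + `|f| * `|y - val w|.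
      have -> : val (z + w) = val z + val w by exact: linearD.
      by rewrite -mulrDr ler_wpM2l// opprD addrACA ler_normD.
    have -> : (f (z + w) : R) = (f z : R) + (f w : R) by exact: linearD.
    lra.
  rewrite le_eqVlt => /predU1P[<-|b0].
    rewrite scale0r mul0r; apply/eqP; rewrite eq_le; apply/andP; split.
      by rewrite (le_trans (ple _ 0))// v0 subr0 normr0 mulr0 addr0 linear0.
    apply: lep => z; have := Slb 0 _ (ex_intro2 _ _ z I erefl).
    by rewrite normr0 mulr0 oppr0.
  apply/eqP; rewrite eq_le hom// andbT.
  rewrite -ler_pdivrMl// -[in leRHS](scale1r y) -(mulVf (lt0r_neq0 b0)) -scalerA.
  by rewrite hom// invr_gt0.
have [h hp] := hahn_banach sp.
have hM y : h y <= `|f| * `|y|.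
  by rewrite (le_trans (hp y))// (le_trans (ple y 0))// linear0 add0r v0 subr0.
have [g [gf gh]] := dual_of_le (normr_ge0 f) hM; exists g; split=> // z.
have hf w : h (val w) <= f w.
  by rewrite (le_trans (hp _))// (le_trans (ple _ w))// subrr normr0 mulr0 addr0.
apply/eqP; rewrite gh eq_le hf/=.
by have := hf (- z); rewrite !linearN lerN2.
Qed.

End NormedHahnBanach.

(** * Bounded operators, adjoints and elementary tensors *)

Section Operators.
Context {R : realType}.
Implicit Types X Y V : normedModType R.

Lemma opnorm_bound X Y (f : bop X Y) x : `|f x| <= `|f| * `|x|.
Proof. exact: le_opnorm. Qed.

Lemma dual_bound V (g : dual V) v : `|(g v : R)| <= `|g| * `|v|.
Proof. exact: (le_opnorm g v). Qed.

Lemma dual_le V (g : dual V) (v : V) c d : `|g| <= c -> `|v| <= d ->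
  (g v : R) <= c * d.
Proof.
move=> gc vd; rewrite (le_trans (ler_norm _))// (le_trans (dual_bound g v))//.
exact: ler_pM.
Qed.

Lemma dual_abs_le V (g : dual V) (v : V) c d : `|g| <= c -> `|v| <= d ->
  `|g v : R| <= c * d.
Proof.
move=> gc vd; rewrite (le_trans (dual_bound g v))//; exact: ler_pM.
Qed.

Lemma dual_eq0 V (g : dual V) : (forall v, (g v : R) = 0) -> g = 0.
Proof. by move=> g0; apply/val_inj/funext => v; exact: g0. Qed.

Lemma canonical_bounded V (v : V) :
  (fun g : dual V => g v) \in bounded_linear (dual V) R^o.
Proof.
rewrite inE; split; first by [].
by exists `|v| => g; rewrite mulrC; exact: opnorm_bound.
Qed.

(** The canonical embedding into the bidual. *)
Definition canonical V (v : V) : dual (dual V) := Bop (canonical_bounded v).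

Lemma canonical_norm V (v : V) : `|canonical v| <= `|v|.
Proof. by apply: opnorm_leM => // g; rewrite mulrC; exact: (dual_bound g v). Qed.

Lemma adjoint_linear X Y : linear (@adjoint R X Y).
Proof.
move=> a S U; apply/val_inj/funext => g; apply/val_inj/funext => x.
by have := linearP g a (S x) (U x).
Qed.

Lemma adjoint_norm_le X Y (S : bop X Y) : `|adjoint S| <= `|S|.
Proof.
apply: opnorm_leM => // g; rewrite mulrC; apply: opnorm_leM => [|x].
  by rewrite mulr_ge0.
rewrite -mulrA; apply: le_trans (opnorm_bound g (S x)) _.
by rewrite ler_wpM2l// opnorm_bound.
Qed.

Definition pairing X Y (S : bop X Y) (x : dual (dual X)) (y : dual Y) : R :=
  x (adjoint S y).

Lemma pairing_le X Y (S : bop X Y) x y : `|x| <= 1 -> `|y| <= 1 ->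
  pairing S x y <= `|S|.
Proof.
move=> x1 y1; rewrite /pairing -[leRHS]mul1r; apply: dual_le => //.
rewrite (le_trans (opnorm_bound _ _))// (le_trans (ler_wpM2l _ y1))//.
by rewrite mulr1 adjoint_norm_le.
Qed.

Lemma pairing_abs_le X Y (S : bop X Y) x y : `|pairing S x y| <= `|x| * `|y| * `|S|.
Proof.
rewrite (le_trans (dual_bound _ _))// -mulrA ler_wpM2l//.
by rewrite (le_trans (opnorm_bound _ _))// mulrC ler_wpM2l// adjoint_norm_le.
Qed.

Lemma pairing_linear X Y (x : dual (dual X)) (y : dual Y) :
  linear (fun S : bop X Y => pairing S x y : R^o).
Proof. by move=> a S U; rewrite /pairing adjoint_linear -linearP. Qed.

Lemma pairing_bounded X Y (x : dual (dual X)) (y : dual Y) :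
  (fun S : bop X Y => pairing S x y : R^o) \in bounded_linear (bop X Y) R^o.
Proof.
rewrite inE; split; first exact: pairing_linear.
by exists (`|x| * `|y|) => S; exact: pairing_abs_le.
Qed.

Definition tensor X Y (x : dual (dual X)) (y : dual Y) : dual (bop X Y) :=
  Bop (pairing_bounded x y).

Lemma tensor_norm_le X Y (x : dual (dual X)) (y : dual Y) :
  `|tensor x y| <= `|x| * `|y|.
Proof.
by apply: opnorm_leM => [|S]; [rewrite mulr_ge0|exact: pairing_abs_le].
Qed.

Lemma rank1_bounded X Y (g : dual X) (w : Y) :
  (fun x => (g x : R) *: w) \in bounded_linear X Y.
Proof.
rewrite inE; split=> [a x y|].
  by rewrite linearP scalerDl scalerA.
exists (`|g| * `|w|) => x; rewrite normrZ mulrAC ler_wpM2r//.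
exact: opnorm_bound.
Qed.

Definition rank1 X Y (g : dual X) (w : Y) : bop X Y := Bop (rank1_bounded g w).

Lemma pairing_rank1 X Y (g : dual X) (w : Y) x y :
  pairing (rank1 g w) x y = (y w : R) * (x g : R).
Proof.
rewrite /pairing; have -> : adjoint (rank1 g w) y = (y w : R) *: g.
  by apply/val_inj/funext => v; rewrite /= linearZ; exact: mulrC.
by rewrite linearZ.
Qed.

End Operators.

(** * Weak-star limits along an ultrafilter *)

Section UltraLimits.
Context {R : realType} {I : Type} (U : set_system I) {UF : UltraFilter U}.

Lemma bounded_ultra_cvg (u : I -> R) (M : R) : (forall i, `|u i| <= M) ->
  exists l : R, u @ U --> l.
Proof.
move=> uM; have [|l [_ cl]] := @segment_compact R (- M) M (u @ U) _.
  apply: (@filterS _ U _ setT) => [i _ /=|]; last exact: filterT.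
  by rewrite in_itv/= -ler_norml.
exists l => B lB; have [//|UB] := in_ultra_setVsetC (u @^-1` B) UF.
by have [x [nBx Bx]] := cl (~` B) B UB lB.
Qed.

(** Banach-Alaoglu: pointwise limits of bounded functionals are taken along an
    ultrafilter, so that no topology on the dual is needed. *)
Lemma ball_ultra_cvg (V : normedModType R) (f : I -> dual V) :
  (forall i, `|f i| <= 1) ->
  exists g : dual V, `|g| <= 1 /\ forall v, (fun i => f i v : R) @ U --> (g v : R).
Proof.
move=> f1; have fle i v : `|f i v : R| <= `|v|.
  by rewrite -[leRHS]mul1r; exact: dual_abs_le.
have /choice[l fl] v : exists l : R, (fun i => f i v : R) @ U --> l.
  by apply: (bounded_ultra_cvg (M := `|v|)) => i; exact: fle.
have ll : linear (l : V -> R^o).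
  move=> a v w; apply: (cvg_unique _ (fl (a *: v + w))) => //=.
  have -> : (fun i => f i (a *: v + w) : R) =
      (fun i => a * (f i v : R)) \+ (fun i => f i w : R).
    by apply/funext => i; exact: linearP.
  by apply: cvgD; [apply: cvgMl_tmp; exact: fl|exact: fl].
pose L : {linear V -> R^o} := HB.pack_for {linear V -> R^o} (l : V -> R^o)
  (GRing.isLinear.Build R V R^o _ (l : V -> R^o) ll).
have lM v : L v <= 1 * `|v|.
  rewrite mul1r; apply: (cvgr_to_le (fl v)); apply: nearW => i.
  by rewrite (le_trans (ler_norm _)).
have [g [g1 gL]] := dual_of_le ler01 lM; exists g; split=> // v.
by rewrite gL; exact: fl.
Qed.

End UltraLimits.

Section WeakStarContinuity.
Context {R : realType} (X Y : normedModType R).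
Context {I : Type} (U : set_system I) {UF : UltraFilter U}.

(** Joint weak-star continuity of (x, y) |-> x (S^* y) on the product of the
    unit balls, tested along U. *)
Definition wstar_cont (S : bop X Y) : Prop :=
  forall (xs : I -> dual (dual X)) (ys : I -> dual Y)
      (x : dual (dual X)) (y : dual Y),
    (forall i, `|xs i| <= 1) -> (forall i, `|ys i| <= 1) ->
    `|y| <= 1 ->
    (forall g, (fun i => xs i g : R) @ U --> (x g : R)) ->
    (forall w, (fun i => ys i w : R) @ U --> (y w : R)) ->
    (fun i => pairing S (xs i) (ys i)) @ U --> pairing S x y.

Lemma wstar_cont_linear a (S S' : bop X Y) :
  wstar_cont S -> wstar_cont S' -> wstar_cont (a *: S + S').
Proof.
move=> cS cS' xs ys x y xs1 ys1 y1 xsx ysy.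
have cSi := cS _ _ _ _ xs1 ys1 y1 xsx ysy.
have cSi' := cS' _ _ _ _ xs1 ys1 y1 xsx ysy.
have -> : (fun i => pairing (a *: S + S') (xs i) (ys i)) =
    (fun i => a * pairing S (xs i) (ys i)) \+ (fun i => pairing S' (xs i) (ys i)).
  by apply/funext => i; exact: pairing_linear.
have -> : pairing (a *: S + S') x y = a * pairing S x y + pairing S' x y.
  exact: pairing_linear.
by apply: cvgD => //; exact: cvgMl_tmp.
Qed.

Lemma wstar_cont_rank1 (g : dual X) (w : Y) : wstar_cont (rank1 g w).
Proof.
move=> xs ys x y _ _ _ xsx ysy; rewrite pairing_rank1.
under eq_fun do rewrite pairing_rank1.
exact: cvgM (ysy w) (xsx g).
Qed.

Lemma wstar_cont_sum n (c : 'I_n -> R) (S : 'I_n -> bop X Y) :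
  (forall j, wstar_cont (S j)) -> wstar_cont (\sum_j c j *: S j).
Proof.
move=> cS; have c0 : wstar_cont 0.
  have -> : 0 = rank1 0 0 :> bop X Y.
    by apply/val_inj/funext => v; rewrite /= scaler0.
  exact: wstar_cont_rank1.
elim/big_rec: _ => // j S' _ cS'; exact: wstar_cont_linear.
Qed.

(** A compact adjoint turns weak-star convergence into norm convergence: a
    family of 1-Lipschitz functions that converges pointwise converges uniformly
    on the compact closure of the image of the ball. *)
Lemma wstar_cont_compact (S : bop X Y) : compact_operator S -> wstar_cont S.
Proof.
move=> cS xs ys x y xs1 ys1 y1 xsx ysy.
have unif e : 0 < e -> \forall i \near U, `|adjoint S (ys i) - adjoint S y| <= e.
  move=> e0; have e30 : 0 < e / 3 by rewrite divr_gt0.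
  have /compact_near_coveringP/(_ I U (fun i w => `|(ys i w : R) - y w| <= e)) := cS.
  have near_cover w : closure (S @` unit_ball X) w ->
      \forall w' \near w & i \near U, `|(ys i w' : R) - y w'| <= e.
    move=> _; have /cvgrPdistC_le/(_ _ e30) iw0 := ysy w.
    exists (ball w (e / 3), [set i | `|(ys i w : R) - y w| <= e / 3]) => /=.
      by split=> //; exact: nbhsx_ballx.
    move=> [w' i] /= []; rewrite -ball_normE/= => /ltW ww' iw.
    have h1 := dual_abs_le (ys1 i) ww'; have h2 := dual_abs_le y1 ww'.
    move: h1 h2 iw; rewrite !linearB/= !mul1r.
    rewrite -[_ - _ : R^o]/(_ - _ : R).
    rewrite !ler_norml; lra.
  move=> /(_ _ near_cover); apply: filterS => i Pi.
  apply: opnorm_le => v v1; apply: (Pi (S v)).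
  by apply: subset_closure; exists v.
apply/cvgrPdist_le => e e0; have e20 : 0 < e / 2 by rewrite divr_gt0.
have /cvgrPdist_le/(_ _ e20) h1 := xsx (adjoint S y).
apply: filterS2 h1 (unif _ e20) => i h1 h2.
have := dual_abs_le (xs1 i) h2; move: h1; rewrite linearB/= /pairing mul1r.
rewrite -[_ - _ : R^o]/(_ - _ : R) !ler_norml; lra.
Qed.

End WeakStarContinuity.

(** * Convexity in finite dimension *)

Section FiniteDimension.
Context {R : realType}.

Lemma ex_dependency n k (F : 'I_n -> 'I_k -> R) : (k < n)%N ->
  exists a : 'I_n -> R, (exists i, a i != 0) /\
    forall j, \sum_i a i * F i j = 0.
Proof.
move=> kn; pose A := \matrix_(i, j) F i j.
have /rowV0Pn[a /sub_kermxP aA a0] : kermx A != 0.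
  by rewrite -mxrank_eq0 mxrank_ker -lt0n subn_gt0 (leq_ltn_trans (rank_leq_col A)).
exists (fun i => a 0 i); split.
  by move/rV0Pn: a0 => [i ai]; exists i.
move=> j; have /rowP/(_ j) := aA; rewrite !mxE => e; rewrite -[RHS]e.
by apply: eq_bigr => i _; rewrite mxE.
Qed.

Definition weights n (t : 'I_n -> R) : Prop :=
  (forall i, 0 <= t i) /\ \sum_i t i = 1.

Lemma weights_le1 n (t : 'I_n -> R) i : weights t -> t i <= 1.
Proof. by move=> [t0 <-]; rewrite (bigD1 i)//= lerDl sumr_ge0. Qed.

(** Moving along an affine dependency until the first weight vanishes. *)
Lemma caratheodory_step m (v : 'I_m.+2 -> 'I_m -> R) (t : 'I_m.+2 -> R) :
  weights t -> exists (i0 : 'I_m.+2) (s : 'I_m.+1 -> R), weights s /\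
    forall j, \sum_i s i * v (lift i0 i) j = \sum_i t i * v i j.
Proof.
move=> [t0 t1].
(* the last column, constantly 1, makes the coefficients sum to 0 *)
have [a [[i1 ai1] adep]] := @ex_dependency m.+2 m.+1
  (fun i j => if unlift ord_max j is Some k then v i k else 1) (ltnSn _).
have a_sum : \sum_i a i = 0.
  rewrite -[RHS](adep ord_max); apply: eq_bigr => i _.
  by rewrite unlift_none mulr1.
have a_v j : \sum_i a i * v i j = 0.
  by rewrite -[RHS](adep (lift ord_max j)); apply: eq_bigr => i _; rewrite liftK.
have [i2 ai2] : exists i, 0 < a i.
  apply/existsP; apply: contraT => /existsPn aN.
  suff : a i1 == 0 by rewrite (negbTE ai1).
  have /psumr_eq0P h : forall i, true -> 0 <= - a i.
    by move=> i _; rewrite oppr_ge0 leNgt aN.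
  have := h _ i1 isT; rewrite sumrN a_sum oppr0 => /(_ erefl)/eqP.
  by rewrite oppr_eq0.
case: (@arg_minP _ _ _ i2 (fun i => 0 < a i) (fun i => t i / a i) ai2) => i0 ai0 i0min.
pose tau := t i0 / a i0; pose s i := t i - tau * a i.
have tau0 : 0 <= tau by rewrite divr_ge0// ltW.
have s0 i : 0 <= s i.
  rewrite subr_ge0; have [ai|ai] := ltP 0 (a i).
    by rewrite -ler_pdivlMr// i0min.
  by rewrite (le_trans _ (t0 i))// mulr_ge0_le0.
have si0 : s i0 = 0 by rewrite /s /tau divfK ?subrr// gt_eqF.
have s_sum : \sum_i s i = 1 by rewrite sumrB t1 -mulr_sumr a_sum mulr0 subr0.
have s_v j : \sum_i s i * v i j = \sum_i t i * v i j.
  under eq_bigr do rewrite mulrBl -mulrA.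
  by rewrite sumrB -mulr_sumr a_v mulr0 subr0.
exists i0, (fun i => s (lift i0 i)); split=> [|j].
  by split=> //; rewrite -s_sum (bigD1_ord i0)//= si0 add0r.
by rewrite -s_v (bigD1_ord i0)//= si0 mul0r add0r.
Qed.

End FiniteDimension.

Lemma cvg_sum_ord {R : realType} {I : Type} (F : set_system I) {FF : Filter F}
    n (f : 'I_n -> I -> R) (l : 'I_n -> R) :
  (forall i, f i @ F --> l i) ->
  (fun x => \sum_i f i x) @ F --> \sum_i l i.
Proof.
move=> fl; have -> : (fun x => \sum_i f i x) = \sum_i f i.
  by apply/funext => x; rewrite fct_sumE.
apply: (big_ind2 (fun (u : I -> R) (v : R) => u @ F --> v)) => //.
  exact: cvg_cst.
by move=> u v u' v' uv uv'; exact: cvgD.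
Qed.

Section ZeroInHull.
Context {R : realType} {O : Type} (U : set_system nat) {UF : UltraFilter U}.
Context (m : nat) (g : O -> 'I_m -> R).

(** By Caratheodory's theorem combinations of m + 1 points suffice, so that the
    least norm on the convex hull is attained, at some p. If p were nonzero,
    moving from p towards a point g w with p . g w <= 0 would decrease the norm. *)
Lemma zero_in_hull : \oo `<=` U ->
  (forall w : nat -> O, exists w0, forall j, (fun n => g (w n) j) @ U --> g w0 j) ->
  (forall c : 'I_m -> R, exists w, \sum_j c j * g w j <= 0) ->
  exists (t : 'I_m.+1 -> R) (w : 'I_m.+1 -> O),
    weights t /\ forall j, \sum_i t i * g (w i) j = 0.
Proof.
move=> ooU cpt half.
pose comb (t : 'I_m.+1 -> R) (w : 'I_m.+1 -> O) j := \sum_i t i * g (w i) j.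
pose nrm2 t w := \sum_j comb t w j ^+ 2.
pose A := [set nrm2 p.1 p.2 | p in
  [set p : ('I_m.+1 -> R) * ('I_m.+1 -> O) | weights p.1]].
have [w0 _] := half (fun=> 0).
have A_inf : has_inf A.
  split; last by exists 0 => _ [p _ <-]; apply: sumr_ge0 => j _; rewrite sqr_ge0.
  pose t (i : 'I_m.+1) : R := (i == ord0)%:R.
  exists (nrm2 t (fun=> w0)), (t, fun=> w0) => //=; split=> [i|].
    by rewrite /t ler0n.
  rewrite (bigD1 ord0)//= /t eqxx big1 ?addr0// => i; by case: eqP.
pose r := inf A.
have r_le t w : weights t -> r <= nrm2 t w.
  by move=> tw; apply: ge_inf; [case: A_inf|exists (t, w)].
have /choice[s sP] n : exists p : ('I_m.+1 -> R) * ('I_m.+1 -> O),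
    weights p.1 /\ nrm2 p.1 p.2 < r + n.+1%:R^-1.
  have e0 : 0 < n.+1%:R^-1 :> R by rewrite invr_gt0 ltr0n.
  by have [_ [p tp <-] h] := inf_adherent e0 A_inf; exists p.
have /choice[t tlim] i : exists l : R, (fun n => (s n).1 i) @ U --> l.
  apply: (bounded_ultra_cvg (M := 1)) => n; have [sw _] := sP n.
  by rewrite ger0_norm ?weights_le1//; case: sw.
have /choice[w wlim] i : exists w, forall j, (fun n => g ((s n).2 i) j) @ U --> g w j.
  exact: cpt.
have tw : weights t.
  split=> [i|].
    by apply: (cvgr_to_ge (tlim i)); apply: nearW => n; case: (sP n) => -[].
  have : (fun n => \sum_i (s n).1 i) @ U --> \sum_i t i.
    by apply: cvg_sum_ord => i; exact: tlim.
  have -> : (fun n => \sum_i (s n).1 i) = cst 1.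
    by apply/funext => n; case: (sP n) => -[].
  by move=> h; apply/esym; apply: (cvg_unique _ _ h) => //; exact: cvg_cst.
have clim j : (fun n => comb (s n).1 (s n).2 j) @ U --> comb t w j.
  by apply: cvg_sum_ord => i; apply: cvgM; [exact: tlim|exact: wlim].
have nlim : (fun n => nrm2 (s n).1 (s n).2) @ U --> nrm2 t w.
  by apply: cvg_sum_ord => j; apply: cvgM; exact: clim.
have nr : nrm2 t w = r.
  apply/eqP; rewrite eq_le r_le// andbT.
  have hl : (fun n => r + n.+1%:R^-1) @ U --> r + 0.
    apply: cvgD; first exact: cvg_cst.
    by apply: cvg_trans (@cvg_harmonic R); exact: cvg_app.
  rewrite -[leRHS]addr0; apply: (ler_cvg_to nlim hl); apply: nearW => n.
  by case: (sP n) => _ /ltW.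
exists t, w; split=> // j.
suff r0 : r = 0.
  move: nr; rewrite r0 => /psumr_eq0P h; apply/eqP; rewrite -sqrf_eq0.
  by apply/eqP/h => // k _; rewrite sqr_ge0.
apply/eqP; apply: contraT => rN0.
have r_gt0 : 0 < r.
  by rewrite lt_neqAle eq_sym rN0 -nr sumr_ge0// => k _; rewrite sqr_ge0.
have [w' hw'] := half (comb t w).
pose G := \sum_k g w' k ^+ 2.
have G0 : 0 <= G by apply: sumr_ge0 => k _; rewrite sqr_ge0.
have rG : 0 < r + G by rewrite ltr_wpDr.
(* the minimiser of (1 - a)^2 r + a^2 G *)
pose a := r / (r + G).
have a0 : 0 <= a by rewrite divr_ge0 ?ltW.
have a1 : a <= 1 by rewrite ler_pdivrMr// mul1r lerDl.
pose t2 (i : 'I_m.+2) := if unlift ord0 i is Some k then (1 - a) * t k else a.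
pose w2 (i : 'I_m.+2) := if unlift ord0 i is Some k then w k else w'.
have t2w : weights t2.
  split=> [i|].
    rewrite /t2; case: unliftP => [k _|_]//.
    by rewrite mulr_ge0 ?subr_ge0//; case: tw.
  rewrite big_ord_recl /t2 unlift_none.
  under eq_bigr do rewrite liftK.
  by rewrite -mulr_sumr (proj2 tw) mulr1 addrC subrK.
(* back from m + 2 points to m + 1 *)
have [i0 [u [uw ucomb]]] := caratheodory_step (fun i => g (w2 i)) t2w.
suff : nrm2 u (fun i => w2 (lift i0 i)) < r by rewrite ltNge r_le.
have -> : nrm2 u (fun i => w2 (lift i0 i)) =
    \sum_k ((1 - a) * comb t w k + a * g w' k) ^+ 2.
  apply: eq_bigr => k _; congr (_ ^+ 2); rewrite /comb ucomb big_ord_recl.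
  rewrite /t2 /w2 unlift_none addrC; congr (_ + _).
  by rewrite mulr_sumr; apply: eq_bigr => i _; rewrite liftK mulrA.
have -> : \sum_k ((1 - a) * comb t w k + a * g w' k) ^+ 2 =
    (1 - a) ^+ 2 * r + a * (1 - a) *+ 2 * (\sum_k comb t w k * g w' k) + a ^+ 2 * G.
  rewrite -nr /nrm2 /G !mulr_sumr -!big_split/=; apply: eq_bigr => k _; ring.
have h : a * (1 - a) *+ 2 * (\sum_k comb t w k * g w' k) <= 0.
  by rewrite mulr_ge0_le0// mulrn_wge0// mulr_ge0// subr_ge0.
have rE : r = (1 - a) ^+ 2 * r + a ^+ 2 * G + r ^+ 2 / (r + G).
  by rewrite /a; field; rewrite gt_eqF.
have : 0 < r ^+ 2 / (r + G) by rewrite divr_gt0// exprn_gt0.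
move: rE h; set b := (1 - a) ^+ 2 * r; set c := _ * \sum_k _.
set d := a ^+ 2 * G; set e := r ^+ 2 / _ => rE h e0.
by rewrite [ltRHS]rE addrAC; lra.
Qed.

End ZeroInHull.

(** * Extreme points of finite-dimensional convex sets *)

Section ConvexCombinations.
Context {R : realType}.
Implicit Types V W : lmodType R.

Definition convex_comb V (E : set V) x : Prop := exists n (t : 'I_n -> R) (p : 'I_n -> V),
  [/\ weights t, forall i, E (p i) & x = \sum_i t i *: p i].

Lemma convex_comb1 V (E : set V) x : E x -> convex_comb E x.
Proof.
move=> Ex; exists 1%N, (fun=> 1), (fun=> x); split=> //.
  by split=> [i|]; rewrite ?big_ord1// ler01.
by rewrite big_ord1 scale1r.
Qed.

Lemma convex_comb_segment V (E : set V) x y a : 0 <= a <= 1 ->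
  convex_comb E x -> convex_comb E y -> convex_comb E (a *: x + (1 - a) *: y).
Proof.
move=> /andP[a0 a1] [n [t [p [[t0 t1] Ep ->]]]] [m [s [q [[s0 s1] Eq ->]]]].
exists (n + m)%N,
  (fun k : 'I_(n + m) =>
    match fintype.split k with inl i => a * t i | inr j => (1 - a) * s j end),
  (fun k : 'I_(n + m) => match fintype.split k with inl i => p i | inr j => q j end).
split; first split.
- by move=> k; case: (fintype.split k) => i; rewrite mulr_ge0// subr_ge0.
- rewrite big_split_ord/=.
  under eq_bigr do rewrite (unsplitK (inl _)).
  under [X in _ + X]eq_bigr do rewrite (unsplitK (inr _)).
  by rewrite -!mulr_sumr t1 s1 !mulr1 addrC subrK.
- by move=> k; case: (fintype.split k).
rewrite big_split_ord/= !scaler_sumr.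
under [X in _ = X + _]eq_bigr do rewrite (unsplitK (inl _)) -scalerA.
by under [X in _ = _ + X]eq_bigr do rewrite (unsplitK (inr _)) -scalerA.
Qed.

Lemma convex_comb_linear V W (f : {linear V -> W}) (E : set V) (F : set W) x :
  (forall v, E v -> F (f v)) -> convex_comb E x -> convex_comb F (f x).
Proof.
move=> EF [n [t [p [tw Ep ->]]]]; exists n, t, (f \o p); split=> //.
  by move=> i; exact/EF/Ep.
by rewrite linear_sum; apply: eq_bigr => i _; rewrite linearZ.
Qed.

Lemma sum_enum_sigma (M : nmodType) n (m : 'I_n -> nat)
    (J := {i : 'I_n & 'I_(m i)} : finType) (G : forall i, 'I_(m i) -> M) :
  \sum_(k < #|J|) G (tag (enum_val k : J)) (tagged (enum_val k : J)) =
  \sum_i \sum_j G i j.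
Proof.
rewrite sig_big_dep/= (reindex (@enum_val J predT))//.
exact/onW_bij/enum_val_bij.
Qed.

Lemma convex_comb_idem V (E : set V) x :
  convex_comb (convex_comb E) x -> convex_comb E x.
Proof.
move=> [n [t [p [[t0 t1] Ep ->]]]].
have /choice[m mP] i : exists m, exists q : ('I_m -> R) * ('I_m -> V),
    [/\ weights q.1, forall j, E (q.2 j) & p i = \sum_j q.1 j *: q.2 j].
  by have [m [s [q sq]]] := Ep i; exists m, (s, q).
pose q i := projT1 (cid (mP i)); pose qP i := projT2 (cid (mP i)).
pose J : finType := {i : 'I_n & 'I_(m i)}.
exists #|J|, (fun k => let u := enum_val k : J in t (tag u) * (q (tag u)).1 (tagged u)),
  (fun k => let u := enum_val k : J in (q (tag u)).2 (tagged u)).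
split=> [|k|]; first split.
- by move=> k; rewrite mulr_ge0//; case: (qP (tag (enum_val k : J))) => -[].
- rewrite (sum_enum_sigma (fun i j => t i * (q i).1 j)) -[RHS]t1.
  apply: eq_bigr => i _; rewrite -mulr_sumr.
  by case: (qP i) => -[_ ->] _ _; rewrite mulr1.
- by case: (qP (tag (enum_val k : J))).
rewrite (sum_enum_sigma (fun i j => (t i * (q i).1 j) *: (q i).2 j)).
apply: eq_bigr => i _; case: (qP i) => _ _ {1}->.
by rewrite scaler_sumr; apply: eq_bigr => j _; rewrite scalerA.
Qed.

End ConvexCombinations.

Section Minkowski.
Context {R : realType} {V : normedModType R}.
Implicit Types (L K E : set V).

(** No family of n elements of L is free. *)
Definition dim_lt L n : Prop := forall b : 'I_n -> V, (forall i, L (b i)) ->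
  exists a : 'I_n -> R, (exists i, a i != 0) /\ \sum_i a i *: b i = 0.

Lemma combine_on_line (x w : V) (l a b : R) :
  l *: (x + a *: w) + (1 - l) *: (x + b *: w) = x + (l * a + (1 - l) * b) *: w.
Proof.
by rewrite !scalerDr !scalerA addrACA -!scalerDl [l + _]addrC subrK scale1r.
Qed.

Context (K : set V).
Hypothesis K_convex : forall x y (a : R), K x -> K y -> 0 <= a <= 1 ->
  K (a *: x + (1 - a) *: y).

(** The directions in which x can be moved both ways inside K. *)
Definition lineality x : set V :=
  [set v | exists2 e : R, 0 < e & K (x + e *: v) /\ K (x - e *: v)].

Lemma K_between x v (e d : R) : K x -> K (x + e *: v) -> 0 <= d <= e ->
  K (x + d *: v).
Proof.
move=> Kx Kxe /andP[d0]; rewrite le_eqVlt => /predU1P[->//|de].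
have e0 : 0 < e := le_lt_trans d0 de.
have -> : x + d *: v = (d / e) *: (x + e *: v) + (1 - d / e) *: x.
  have := combine_on_line x v (d / e) e 0.
  by rewrite scale0r mulr0 !addr0 divfK ?gt_eqF.
apply: K_convex => //; rewrite divr_ge0 ?(ltW e0)//=.
by rewrite ler_pdivrMr// mul1r ltW.
Qed.

Lemma lineality_shrink x v (e d : R) : K x -> 0 < d <= e ->
  K (x + e *: v) /\ K (x - e *: v) -> K (x + d *: v) /\ K (x - d *: v).
Proof.
move=> Kx /andP[d0 de] [Kp Km]; split; first by apply: (K_between Kx Kp); rewrite ltW.
rewrite -scalerN; apply: (K_between (e := e) Kx); rewrite ?scalerN//.
by rewrite ltW.
Qed.

Lemma lineality0 x : K x -> lineality x 0.
Proof. by move=> Kx; exists 1 => //; rewrite scaler0 subr0 addr0. Qed.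

Lemma linealityZ x a v : K x -> lineality x v -> lineality x (a *: v).
Proof.
move=> Kx [e e0 [Kp Km]]; have [->|aN0] := eqVneq a 0.
  by rewrite scale0r; exact: lineality0.
exists (e / `|a|); first by rewrite divr_gt0// normr_gt0.
have [a0|a0] := ltP 0 a.
  by rewrite gtr0_norm// scalerA divfK.
rewrite ler0_norm// scalerA invrN mulrN mulNr divfK// scaleNr opprK; split=> //.
Qed.

Lemma linealityD x v w : K x -> lineality x v -> lineality x w ->
  lineality x (v + w).
Proof.
move=> Kx [e e0 Ke] [d d0 Kd]; pose c := Num.min e d.
have c0 : 0 < c by rewrite lt_min e0.
have ce : 0 < c <= e by rewrite c0 ge_min lexx.
have cd : 0 < c <= d by rewrite c0 ge_min lexx orbT.
have [Kvp Kvm] := lineality_shrink Kx ce Ke.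
have [Kwp Kwm] := lineality_shrink Kx cd Kd.
have half : (1 : R) - 2^-1 = 2^-1 by field.
have hb : 0 <= (2^-1 : R) <= 1 by rewrite invr_ge0 ler0n invf_le1// ler1n.
exists (c / 2); first by rewrite divr_gt0.
have := K_convex Kvm Kwm hb; have := K_convex Kvp Kwp hb; rewrite half.
have xx : x = 2^-1 *: x + 2^-1 *: x 
  by rewrite -scalerDl (_ : 2^-1 + 2^-1 = 1) ?scale1r//; lra.
have e1 (b : R) : 2^-1 *: (x + b *: v) + 2^-1 *: (x + b *: w) = x + (b / 2) *: (v + w).
  rewrite [in RHS]xx !scalerDr addrACA !scalerA; congr (_ + (_ + _)); by rewrite mulrC.
rewrite -!scaleNr !e1 mulNr scaleNr; by split.
Qed.

Lemma lineality_sum x n (a : 'I_n -> R) (b : 'I_n -> V) : K x ->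
  (forall i, lineality x (b i)) -> lineality x (\sum_i a i *: b i).
Proof.
move=> Kx xb; elim/big_ind: _ => [|v w|i _]; first exact: lineality0.
- exact: linealityD.
- exact: linealityZ.
Qed.

(** If x is inside the segment from y to z then x can be moved both ways along
    y - z. *)
Lemma lineality0_extreme x : K x -> (forall v, lineality x v -> v = 0) ->
  extreme_point K x.
Proof.
move=> Kx x0; split=> // y z t Ky Kz /andP[t0 t1] xE.
have yE : y = x + (1 - t) *: (y - z).
  rewrite [in RHS]xE scalerBr addrACA subrr addr0 -scalerDl.
  by rewrite [t + _]addrC subrK scale1r.
have zE : z = x - t *: (y - z).
  rewrite [in RHS]xE scalerBr opprB [t *: z - _]addrC addrACA subrr add0r.
  by rewrite -scalerDl subrK scale1r.
have yz : y - z = 0.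
  apply: x0; exists (Num.min t (1 - t)); first by rewrite lt_min t0 subr_gt0.
  split.
    apply: (K_between (e := 1 - t)) => //; first by rewrite -yE.
    by rewrite le_min ge_min lexx orbT andbT !ltW// subr_gt0.
  rewrite -scalerN; apply: (K_between (e := t)) => //; first by rewrite scalerN -zE.
  by rewrite le_min ge_min lexx andbT !ltW// subr_gt0.
by move: yE zE; rewrite yz !scaler0 addr0 subr0.
Qed.

Hypothesis K_closed : closed K.
Hypothesis K_bounded : exists M : R, forall x, K x -> `|x| <= M.

Lemma line_exit x v : K x -> v != 0 ->
  exists s : R, [/\ 0 <= s, K (x + s *: v) & forall t, s < t -> ~ K (x + t *: v)].
Proof.
move=> Kx v0; have [M KM] := K_bounded.
pose S := [set t : R | K (x + t *: v)].
have S0 : S 0 by rewrite /S/= scale0r addr0.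
have S_sup : has_sup S.
  split; first by exists 0.
  exists ((M + `|x|) / `|v|) => t St.
  rewrite ler_pdivlMr ?normr_gt0// (le_trans (ler_wpM2r _ (ler_norm t)))//.
  rewrite -normrZ -[t *: v](addKr x) (le_trans (ler_normD _ _))// normrN addrC.
  by rewrite lerD2r KM.
have S_closed : closed S.
  apply: (@preimage_closed _ _ (fun t : R => x + t *: v) K) => // t _.
  apply: cvgD; first exact: cvg_cst.
  by apply: cvgZr_tmp; exact: cvg_id.
exists (sup S); split.
- exact: sup_ubound (proj2 S_sup) _ S0.
- by apply: S_closed; apply: closure_sup; case: S_sup.
- by move=> t st /(sup_ubound (proj2 S_sup)); rewrite leNgt st.
Qed.

(** Minkowski's theorem. A point that is not extreme lies on a segment of K
    between two points where the line through it leaves K. At these ends the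
    direction of the line drops out of the lineality space, so the induction is
    on the dimension of that space. *)
Lemma minkowski n x : K x -> dim_lt (lineality x) n.+1 ->
  convex_comb (extreme_point K) x.
Proof.
elim: n x => [|n IH] x Kx dimx.
  apply/convex_comb1/lineality0_extreme => // v xv.
  have [a [[i]]] := dimx (fun=> v) (fun=> xv).
  rewrite ord1 big_ord1 => a0 /eqP.
  by rewrite scaler_eq0 (negbTE a0) => /eqP.
have [x0|] := pselect (forall v, lineality x v -> v = 0).
  by apply/convex_comb1/lineality0_extreme.
move=> /existsNP[v /not_implyP[xv /eqP v0]].
have endpoint w : w != 0 -> lineality x w -> exists s : R, [/\ 0 < s, K (x + s *: w) &
    (forall s' : R, 0 < s' -> K (x - s' *: w) ->
     convex_comb (extreme_point K) (x + s *: w))].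
  move=> w0 xw; have [s [s0 Ks sexit]] := line_exit Kx w0.
  have s_gt0 : 0 < s.
    have [e e0 [Ke _]] := xw; rewrite (lt_le_trans e0)// leNgt.
    by apply/negP => /sexit.
  exists s; split=> // s' s'0 Ks'; apply: IH => // b bL.
  have bLx u : lineality (x + s *: w) u -> lineality x u.
    move=> [e e0 [Kp Km]]; pose l := s' / (s + s').
    have l0 : 0 < l by rewrite divr_gt0// addr_gt0.
    have l1 : 0 <= l <= 1.
      by rewrite ltW//= ler_pdivrMr ?addr_gt0// mul1r lerDr ltW.
    have lE (d : R) : l *: (x + s *: w + d *: u) + (1 - l) *: (x - s' *: w) =
        x + (l * d) *: u.
      rewrite scalerDr -(scaleNr s' w) addrAC combine_on_line scalerA.
      have -> : l * s + (1 - l) * - s' = 0.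
        by rewrite /l; field; rewrite gt_eqF// addr_gt0.
      by rewrite scale0r addr0.
    exists (l * e); first by rewrite mulr_gt0.
    split; first by rewrite -lE; exact: K_convex.
    by rewrite -scaleNr -mulrN -lE scaleNr; exact: K_convex.
  pose b' (i : 'I_n.+2) := if unlift ord0 i is Some k then b k else w.
  have [|a [aN0 a_sum]] := dimx b'.
    by move=> i; rewrite /b'; case: unliftP => // k _; exact: bLx.
  move: a_sum; rewrite big_ord_recl {1}/b' unlift_none.
  under eq_bigr do rewrite /b' liftK.
  move=> a_sum; have [a0|a0] := eqVneq (a ord0) 0.
    exists (fun i => a (lift ord0 i)); split; last first.
      by move: a_sum; rewrite a0 scale0r add0r.
    have [i ai] := aN0; case: (unliftP ord0 i) => [k ik|i0].
      by exists k; rewrite -ik.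
    by move: ai; rewrite i0 a0 eqxx.
  exfalso; have wL : lineality (x + s *: w) w.
    have wE : w = - (a ord0)^-1 *: \sum_i a (lift ord0 i) *: b i.
      apply: (scalerI a0); rewrite scalerA mulrN divff// scaleN1r.
      by apply/eqP; rewrite -addr_eq0 a_sum.
    rewrite [X in lineality _ X]wE; apply: linealityZ => //.
    exact: lineality_sum.
  have [e e0 [Ke _]] := wL; apply: (sexit (s + e)); first by rewrite ltrDl.
  by rewrite scalerDl addrA.
have vN0 : - v != 0 by rewrite oppr_eq0.
have xNv : lineality x (- v) by rewrite -scaleN1r; exact: linealityZ.
have [s [s0 Ks sext]] := endpoint v v0 xv.
have [r [r0 Kr rext]] := endpoint (- v) vN0 xNv.
have -> : x = (r / (r + s)) *: (x + s *: v) + (1 - r / (r + s)) *: (x + r *: - v).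
  rewrite scalerN -(scaleNr r v) combine_on_line.
  have -> : r / (r + s) * s + (1 - r / (r + s)) * - r = 0.
    by field; rewrite gt_eqF// addr_gt0.
  by rewrite scale0r addr0.
apply: convex_comb_segment.
- by rewrite divr_ge0 ?ler_pdivrMr ?mul1r ?addr_gt0// ?lerDl ltW// addr_gt0.
- by apply: (sext r) => //; rewrite -scalerN.
- by apply: (rext s) => //; rewrite scalerN opprK.
Qed.

End Minkowski.

Section Faces.
Context {R : realType} {V : normedModType R} {W : lmodType R}.
Context (phi : dual V) (c : R) (f : {linear V -> W}) (n : nat) (e : 'I_n -> W).

Definition face : set V := [set v | `|v| <= 1 /\ (phi v : R) = c].

Lemma face_closed : closed face.
Proof.
move=> v cv; have near_face d : 0 < d -> exists2 u, face u & `|v - u| <= d.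
  move=> d0; have [u [Fu]] := cv _ (nbhsx_ballx v d d0).
  by rewrite -ball_normE/= => /ltW; exists u.
split; first by apply/ler_addgt0Pr => d /near_face[u [u1 _] vu]; rewrite -(subrK u v)
  (le_trans (ler_normD _ _))// addrC lerD.
apply/eqP; rewrite -subr_eq0 -normr_le0; apply/ler_addgt0Pr => d d0.
have M0 : 0 < `|phi| + 1 by rewrite ltr_wpDl.
have [|u [_ uc] vu] := near_face (d / (`|phi| + 1)); first by rewrite divr_gt0.
have := dual_abs_le (lexx `|phi|) vu; rewrite linearB add0r -uc => /le_trans; apply.
by rewrite mulrA ler_pdivrMr// mulrC ler_pM2l// lerDl.
Qed.

Lemma lin_span_rangeP (w : W) : lin_span (range e) w ->
  exists a : 'I_n -> R, w = \sum_k a k *: e k.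
Proof.
move=> [m [a [b [eb ->]]]].
have /choice[h hP] i : exists k, e k = b i by have [k _ <-] := eb i; exists k.
exists (fun k => \sum_(i | h i == k) a i).
under [RHS]eq_bigr do rewrite scaler_suml.
rewrite [RHS](eq_bigr (fun k => \sum_(i < m | h i == k) a i *: b i)).
  by rewrite (partition_big h predT).
move=> k _; apply: eq_bigr => i /eqP <-.
by rewrite hP.
Qed.

(** Each direction of the face at x is a multiple of the difference of two of its
    points, and f maps it injectively into the span of the n vectors e k. *)
Lemma dim_lineality x : face x ->
  (forall v, f v = 0 -> v = 0) ->
  (forall v, face v -> lin_span (range e) (f v)) ->
  dim_lt (lineality face x) n.+1.
Proof.
move=> Fx finj Fe b bL.
have /choice[A AE] i : exists a : 'I_n -> R, f (b i) = \sum_k a k *: e k.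
  have [d d0 [Fd _]] := bL i.
  have [a1 E1] := lin_span_rangeP (Fe _ Fd).
  have [a2 E2] := lin_span_rangeP (Fe _ Fx).
  exists (fun k => d^-1 * (a1 k - a2 k)).
  transitivity (d^-1 *: (f (x + d *: b i) - f x)).
    by rewrite -linearB [x + _]addrC addrK linearZ/= scalerA mulVf ?gt_eqF// scale1r.
  rewrite E1 E2 -sumrB scaler_sumr; apply: eq_bigr => k _.
  by rewrite -scalerBl scalerA.
have [a [aN0 aA]] := ex_dependency A (ltnSn n).
exists a; split=> //; apply: finj; rewrite linear_sum.
under eq_bigr do rewrite linearZ/= AE scaler_sumr.
rewrite exchange_big/= big1// => k _.
under eq_bigr do rewrite scalerA.
by rewrite -scaler_suml aA scale0r.
Qed.

(** The bound c on phi is attained at an inner point of a segment only if it is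
    attained at both ends. *)
Lemma face_extreme x : (forall v, `|v| <= 1 -> (phi v : R) <= c) ->
  extreme_point face x -> extreme_point (unit_ball V) x.
Proof.
move=> phic [[x1 xc] xext]; split=> // y z t y1 z1 t01 xE.
have /andP[t0 t1] := t01.
have : (phi x : R) = t * (phi y : R) + (1 - t) * (phi z : R).
  by rewrite xE; have := linearP phi t y ((1 - t) *: z); rewrite linearZ.
rewrite xc => e1; have yc := phic _ y1; have zc := phic _ z1.
have t1' : 0 < 1 - t by rewrite subr_gt0.
apply: (xext y z t) => //; split=> //; apply/eqP; rewrite eq_le ?yc ?zc/=.
  by rewrite -(ler_pM2l t0); have := ler_wpM2l (ltW t1') zc; lra.
by rewrite -(ler_pM2l t1'); have := ler_wpM2l (ltW t0) yc; lra.
Qed.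

Lemma face_minkowski x : face x ->
  (forall v, `|v| <= 1 -> (phi v : R) <= c) ->
  (forall v, f v = 0 -> v = 0) ->
  (forall v, face v -> lin_span (range e) (f v)) ->
  convex_comb (face `&` extreme_point (unit_ball V)) x.
Proof.
move=> Fx phic finj Fe.
have [||||m [t [p [tw pext ->]]]] := @minkowski R V face _ _ _ n x Fx _.
- move=> u v a [u1 uc] [v1 vc] /andP[a0 a1]; split.
    rewrite (le_trans (ler_normD _ _))// !normrZ !ger0_norm ?subr_ge0//.
    have := ler_wpM2l a0 u1; have : (1 - a) * `|v| <= (1 - a) * 1.
      by rewrite ler_wpM2l// subr_ge0.
    lra.
  have -> : (phi (a *: u + (1 - a) *: v) : R) = a * (phi u : R) + (1 - a) * (phi v : R).
    by have := linearP phi a u ((1 - a) *: v); rewrite linearZ.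
  rewrite uc vc; lra.
- exact: face_closed.
- by exists 1 => v [].
- exact: dim_lineality.
exists m, t, p; split=> // i; split; first by case: (pext i).
exact: face_extreme.
Qed.

End Faces.

(** * Norming pairs of a multi-smooth operator *)

Section OperatorSums.
Context {R : realType}.

Lemma bop_sumE (X Y : normedModType R) n (c : 'I_n -> R) (S : 'I_n -> bop X Y) v :
  (\sum_j c j *: S j) v = \sum_j c j *: S j v.
Proof. by elim/big_ind2: _ => // S1 v1 S2 v2 <- <-. Qed.

Lemma dual_sumE (X : normedModType R) n (c : 'I_n -> R) (S : 'I_n -> dual X) v :
  ((\sum_j c j *: S j) v : R) = \sum_j c j * (S j v : R).
Proof. exact: bop_sumE. Qed.

Lemma pairing_sum (X Y : normedModType R) n (c : 'I_n -> R) (S : 'I_n -> bop X Y) x y :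
  pairing (\sum_j c j *: S j) x y = \sum_j c j * pairing (S j) x y.
Proof.
rewrite -[LHS]/(tensor x y (\sum_j c j *: S j)) linear_sum.
by apply: eq_bigr => j _; rewrite linearZ.
Qed.

Lemma csub_sum (Y : normedModType R) (Z : closedSubspace Y) n (c : 'I_n -> R)
    (z : 'I_n -> Y) :
  (forall j, (Z : set Y) (z j)) -> (Z : set Y) (\sum_j c j *: z j).
Proof.
move=> Zz; suff : \sum_j c j *: z j \in csub_pred Z by rewrite inE.
by apply: rpred_sum => j _; apply: rpredZ; rewrite inE.
Qed.

End OperatorSums.

Section NormingPairs.
Context {R : realType} (X Y : normedModType R).

Definition norming_pair (T : bop X Y) (x : dual (dual X)) (y : dual Y) : Prop :=
  [/\ `|x| <= 1, `|y| <= 1 & pairing T x y = `|T|].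

Lemma near_norming_pair (S : bop X Y) (e : R) : 0 < e ->
  exists x y, [/\ `|x| <= 1, `|y| <= 1 & `|S| - e < pairing S x y].
Proof.
move=> e0; have [_ [v v1 <-] h] := sup_adherent e0 (opnorm_has_sup S).
have [y [y1 yE]] := norming_functional (S v).
exists (canonical v), y; split=> //; first by rewrite (le_trans (canonical_norm v)).
by rewrite /pairing /= yE.
Qed.

Lemma ball_pair_cvg (U : set_system nat) {UF : UltraFilter U}
    (xs : nat -> dual (dual X)) (ys : nat -> dual Y) :
  (forall n, `|xs n| <= 1) -> (forall n, `|ys n| <= 1) ->
  exists x y, [/\ `|x| <= 1, `|y| <= 1 & forall S, wstar_cont U S ->
    (fun n => pairing S (xs n) (ys n)) @ U --> pairing S x y].
Proof.
move=> xs1 ys1; have [x [x1 xlim]] := ball_ultra_cvg (U := U) xs1.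
have [y [y1 ylim]] := ball_ultra_cvg (U := U) ys1.
by exists x, y; split=> // S; apply.
Qed.

(** A pair (x, y) that norms T - e S up to e^2 satisfies
    |T| <= x (T^* y) - e x (S^* y) + e^2, hence x (S^* y) <= e, and
    x (T^* y) >= |T| - e (1 + |S|). The claim follows in the limit e -> 0. *)
Lemma norming_pair_orth (U : set_system nat) {UF : UltraFilter U} (T S : bop X Y) :
  \oo `<=` U -> wstar_cont U T -> wstar_cont U S -> BJ_orth T S ->
  exists x y, norming_pair T x y /\ pairing S x y <= 0.
Proof.
move=> ooU cT cS TS; pose e n : R := n.+1%:R^-1.
have e0 n : 0 < e n by rewrite invr_gt0 ltr0n.
have e1 n : e n <= 1 by rewrite invf_le1 ?ler1n ?ltr0n.
have /choice[p pP] n : exists p : dual (dual X) * dual Y, [/\ `|p.1| <= 1, `|p.2| <= 1 &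
    `|T - e n *: S| - e n ^+ 2 < pairing (T - e n *: S) p.1 p.2].
  have [|x [y [x1 y1 xy]]] := near_norming_pair (T - e n *: S) (e := e n ^+ 2).
    by rewrite exprn_gt0.
  by exists (x, y).
have p1 n : `|(p n).1| <= 1 by case: (pP n).
have p2 n : `|(p n).2| <= 1 by case: (pP n).
have [x [y [x1 y1 lim]]] := ball_pair_cvg (U := U) p1 p2.
have pTS n : pairing (T - e n *: S) (p n).1 (p n).2 =
    pairing T (p n).1 (p n).2 - e n * pairing S (p n).1 (p n).2.
  rewrite addrC -scaleNr; have := pairing_linear (p n).1 (p n).2 (- e n) S T.
  by rewrite /= => ->; rewrite addrC scaleNr.
have h n : `|T| - e n ^+ 2 <
    pairing T (p n).1 (p n).2 - e n * pairing S (p n).1 (p n).2.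
  rewrite -pTS; case: (pP n) => _ _; apply: le_lt_trans; rewrite lerD2r.
  by have := TS (- e n); rewrite scaleNr.
have elim : e @ U --> (0 : R).
  by apply: cvg_trans (@cvg_harmonic R); exact: cvg_app.
have Ple S' n : `|pairing S' (p n).1 (p n).2| <= `|S'|.
  rewrite (le_trans (pairing_abs_le _ _ _))// ler_piMl//.
  by rewrite mulr_ile1.
exists x, y; split; first split=> //.
  apply/eqP; rewrite eq_le pairing_le//=.
  have hl : (fun n => `|T| - e n * (1 + `|S|)) @ U --> `|T| - 0 * (1 + `|S|).
    apply: cvgB; first exact: cvg_cst.
    by apply: cvgM => //; exact: cvg_cst.
  rewrite -[leLHS]subr0 -(mul0r (1 + `|S|)).
  apply: (ler_cvg_to hl (lim _ cT)); apply: nearW => n.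
  have := h n; have := Ple S n; rewrite ler_norml => /andP[a1 a2] a3.
  have b1 : e n * - `|S| <= e n * pairing S (p n).1 (p n).2 by rewrite ler_pM2l.
  have b2 : e n ^+ 2 <= e n * 1 by rewrite expr2 ler_pM2l.
  lra.
apply: (ler_cvg_to (lim _ cS) elim); apply: nearW => n.
rewrite -(ler_pM2l (e0 n)); have := h n; have := Ple T n.
by rewrite ler_norml expr2 => /andP[a1 a2] a3; lra.
Qed.

Lemma tensor_support (T : bop X Y) x y : T <> 0 -> norming_pair T x y ->
  support_functionals T (tensor x y).
Proof.
move=> T0 [x1 y1 xyT]; split=> //; apply/eqP; rewrite eq_le.
rewrite (le_trans (tensor_norm_le _ _)) ?mulr_ile1//=.
have Tgt0 : 0 < `|T| by rewrite normr_gt0; exact/eqP.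
rewrite -(ler_pM2r Tgt0) mul1r -{1}xyT.
by rewrite (le_trans (ler_norm _))//; exact: (dual_bound (tensor x y) T).
Qed.

Lemma lin_span_sub (V : lmodType R) (A : set V) : A `<=` lin_span A.
Proof.
move=> v Av; exists 1%N, (fun=> 1), (fun=> v); split=> //.
by rewrite big_ord1 scale1r.
Qed.

End NormingPairs.

(** A finite family of vectors of maximal rank spans all the others. *)
Lemma spanning_subfamily {F : fieldType} {W : Type} (V : set W) n (ev : W -> 'rV[F]_n) :
  exists m (w : 'I_m -> W), (forall j, V (w j)) /\
    forall w', V w' -> (ev w' <= \matrix_j ev (w j))%MS.
Proof.
pose P r := `[< exists m (w : 'I_m -> W), (forall j, V (w j)) /\
  \rank (\matrix_j ev (w j)) = r >].
have P0 : exists r, P r.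
  exists (\rank (\matrix_(j < 0) (0 : 'rV[F]_n))); apply/asboolP.
  exists 0%N; have w0 : 'I_0 -> W by case.
  by exists w0; split=> [[]//|]; congr mxrank; apply/matrixP => -[].
have Pn r : P r -> (r <= n)%N by move=> /asboolP[m [w [_ <-]]]; exact: rank_leq_col.
have [r /asboolP[m [w [Vw rw]]] rmax] := ex_maxnP P0 Pn.
exists m, w; split=> // w' Vw'.
pose u (j : 'I_m.+1) := if unlift ord0 j is Some k then w k else w'.
have Mu : (\matrix_j ev (w j) <= \matrix_j ev (u j))%MS.
  apply/row_subP => j; rewrite rowK.
  have -> : ev (w j) = row (lift ord0 j) (\matrix_j ev (u j)).
    by rewrite rowK /u liftK.
  exact: row_sub.
have w'u : (ev w' <= \matrix_j ev (u j))%MS.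
  have -> : ev w' = row ord0 (\matrix_j ev (u j)) by rewrite rowK /u unlift_none.
  exact: row_sub.
apply: submx_trans w'u _; rewrite -(mxrank_leqif_sup Mu) eqn_leq mxrankS//= rw.
apply: rmax; apply/asboolP; exists m.+1, u; split=> // j.
by rewrite /u; case: unlift.
Qed.

Section Representation.
Context {R : realType} (X Y : normedModType R) (Z : closedSubspace Y) (T : bop X Y).
Hypotheses (T_compact : compact_operator T) (T_multi_smooth : multi_smooth_finite T).

Definition norming_tensors (A : set (dual (dual X))) (B : set (dual Y)) :
    set (dual (bop X Y)) :=
  [set w | exists x y, [/\ A x, B y, norming_pair T x y & w = tensor x y]].

Definition vanishes_on_rank1 (w : dual (bop X Y)) : Prop :=
  forall (g : dual X) (z : Y), (Z : set Y) z -> (w (rank1 g z) : R) = 0.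

Lemma norming_tensors_span : exists n (e : 'I_n -> dual (bop X Y)),
  forall w, norming_tensors setT setT w -> lin_span (range e) w.
Proof.
have [T0 [n [e Je]]] := T_multi_smooth; exists n, e => _ [x [y [_ _ xyT ->]]].
by rewrite -Je; apply: lin_span_sub; exact: tensor_support.
Qed.

(** The finite-dimensional span of the norming functionals of T reduces the
    vanishing on all weak-star continuous operators into Z to the vanishing on
    finitely many of them, which is a convexity statement about the compact set of
    norming pairs. *)
Lemma orth_convex_comb : BJ_orth_set T (operators_into X Z) ->
  exists2 w, convex_comb (norming_tensors setT setT) w & vanishes_on_rank1 w.
Proof.
move=> TZ; have [U [UF ooU]] := ultraFilterLemma (@eventually_filter).
have cT : wstar_cont U T by exact: wstar_cont_compact.
have [n [e eP]] := norming_tensors_span.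
pose V := [set S : bop X Y | operators_into X Z S /\ wstar_cont U S].
have [m [S [SV Sspan]]] := spanning_subfamily V
  (fun S : bop X Y => \row_k (e k S : R)).
pose O := {p : dual (dual X) * dual Y | norming_pair T p.1 p.2}.
have [||t [p [tw tp]]] := zero_in_hull (U := U)
    (g := fun (p : O) j => pairing (S j) (sval p).1 (sval p).2) ooU.
- move=> p; have [||x [y [x1 y1 lim]]] := @ball_pair_cvg _ X Y U _
    (fun n => (sval (p n)).1) (fun n => (sval (p n)).2).
  + by move=> k; case: (svalP (p k)).
  + by move=> k; case: (svalP (p k)).
  have xyT : norming_pair T x y.
    split=> //; apply: (cvg_unique _ (lim _ cT)) => //.
    have -> : (fun k => pairing T (sval (p k)).1 (sval (p k)).2) = cst `|T|.
      by apply/funext => k; case: (svalP (p k)).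
    exact: cvg_cst.
  exists (exist _ (x, y) xyT) => j; apply: lim.
  by case: (SV j).
- move=> c; pose Sc := \sum_j c j *: S j.
  have [||x [y [xyT xyS]]] := @norming_pair_orth _ X Y U _ T Sc ooU cT.
  + by apply: wstar_cont_sum => j; case: (SV j).
  + by apply: TZ => v; rewrite bop_sumE; apply: csub_sum => j; case: (SV j).
  exists (exist _ (x, y) xyT) => /=; apply: le_trans xyS.
  by rewrite pairing_sum.
exists (\sum_i t i *: tensor (sval (p i)).1 (sval (p i)).2).
  exists _, t, (fun i => tensor (sval (p i)).1 (sval (p i)).2); split=> // i.
  by exists (sval (p i)).1, (sval (p i)).2; split=> //; exact: (svalP (p i)).
(* a combination of the e k that vanishes at the S j vanishes on all of V *)
have [b bE] : exists b : 'I_n -> R,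
    \sum_i t i *: tensor (sval (p i)).1 (sval (p i)).2 = \sum_k b k *: e k.
  have /choice[a aE] i : exists a : 'I_n -> R,
      tensor (sval (p i)).1 (sval (p i)).2 = \sum_k a k *: e k.
    apply/lin_span_rangeP/eP; exists (sval (p i)).1, (sval (p i)).2.
    by split=> //; exact: (svalP (p i)).
  exists (fun k => \sum_i t i * a i k).
  under eq_bigr do rewrite aE scaler_sumr.
  rewrite exchange_big/=; apply: eq_bigr => k _; rewrite scaler_suml.
  by apply: eq_bigr => i _; rewrite scalerA.
move=> g z Zz; have : operators_into X Z (rank1 g z) /\ wstar_cont U (rank1 g z).
  split; last exact: wstar_cont_rank1.
  by move=> v; have := rpredZ (g v : R) (_ : z \in csub_pred Z); rewrite !inE; apply.
move=> /Sspan/submxP[d dE].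
have eE k : (e k (rank1 g z) : R) = \sum_j d 0 j * (e k (S j) : R).
  have /rowP/(_ k) := dE; rewrite !mxE => ->.
  by apply: eq_bigr => j _; rewrite !mxE.
have sumE (w : 'I_n -> R) (Q : bop X Y) :
    ((\sum_k w k *: e k) Q : R) = \sum_k w k * (e k Q : R).
  exact: dual_sumE.
rewrite bE sumE; under eq_bigr do rewrite eE mulr_sumr.
rewrite exchange_big/= big1// => j _.
under eq_bigr do rewrite mulrCA.
rewrite -mulr_sumr -sumE -bE dual_sumE/=.
by rewrite [X in _ * X]tp mulr0.
Qed.

End Representation.

Section ExtremeRepresentation.
Context {R : realType} (X Y : normedModType R) (Z : closedSubspace Y) (T : bop X Y).
Hypotheses (T_compact : compact_operator T) (T_multi_smooth : multi_smooth_finite T).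

Lemma tensor_linear_l (y : dual Y) : linear (fun x => @tensor R X Y x y).
Proof. by move=> a x x'; apply/val_inj/funext. Qed.

Lemma tensor_linear_r (x : dual (dual X)) : linear (@tensor R X Y x).
Proof.
by move=> a y y'; apply/val_inj/funext => S; rewrite /= /pairing linearP/= linearP.
Qed.

Lemma tensor_eq0 (x : dual (dual X)) (y : dual Y) : tensor x y = 0 -> x = 0 \/ y = 0.
Proof.
move=> xy0; have [->|yN0] := pselect (y = 0); [by right|left].
have [w yw] : exists w, (y w : R) <> 0.
  apply: contrapT => h; apply: yN0; apply/val_inj/funext => w.
  by apply: contrapT => yw; apply: h; exists w.
apply/val_inj/funext => g; have : (tensor x y (rank1 g w) : R) = 0 by rewrite xy0.
rewrite /= pairing_rank1 => /eqP; rewrite mulf_eq0 => /orP[/eqP//|/eqP].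
by [].
Qed.

Lemma norming_pair_neq0 x y : norming_pair T x y -> x <> 0 /\ y <> 0.
Proof.
have [T0 _] := T_multi_smooth => -[_ _ xyT].
by split=> e; apply: T0; apply/eqP; rewrite -normr_eq0 -xyT e /pairing ?linear0.
Qed.

(** The norming pairs with a given y form a face of the ball of the bidual. It
    is finite-dimensional because x |-> tensor x y is injective, so its points
    are convex combinations of extreme points of the ball. *)
Lemma norming_tensors_extreme_l w : norming_tensors T setT setT w ->
  convex_comb (norming_tensors T (extreme_point (unit_ball (dual (dual X)))) setT) w.
Proof.
move=> [x [y [_ _ [x1 y1 xyT] ->]]].
have [n [e eP]] := norming_tensors_span T_multi_smooth.
pose f : {linear dual (dual X) -> dual (bop X Y)} :=
  HB.pack_for {linear dual (dual X) -> dual (bop X Y)} (fun x => @tensor R X Y x y)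
  (GRing.isLinear.Build R _ _ _ (fun x => @tensor R X Y x y) (tensor_linear_l y)).
have [_ yN0] := norming_pair_neq0 (And3 x1 y1 xyT).
have phi_le v : `|v| <= 1 -> (canonical (adjoint T y) v : R) <= `|T|.
  by move=> v1; exact: pairing_le.
have f_inj v : f v = 0 -> v = 0 by move=> /tensor_eq0[].
have f_span v : face (canonical (adjoint T y)) `|T| v -> lin_span (range e) (f v).
  by move=> [v1 vT]; apply: eP; exists v, y; split.
have xF := @face_minkowski _ _ _ (canonical (adjoint T y)) _ f n e x
  (conj x1 xyT) phi_le f_inj f_span.
rewrite -[tensor x y]/(f x).
apply: (convex_comb_linear (f := f) _ xF) => p [[p1 pT] pE].
by exists p, y; split.
Qed.

Lemma norming_tensors_extreme_r w : norming_tensors T setT setT w ->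
  convex_comb (norming_tensors T setT (extreme_point (unit_ball (dual Y)))) w.
Proof.
move=> [x [y [_ _ [x1 y1 xyT] ->]]].
have [n [e eP]] := norming_tensors_span T_multi_smooth.
pose f : {linear dual Y -> dual (bop X Y)} :=
  HB.pack_for {linear dual Y -> dual (bop X Y)} (@tensor R X Y x)
  (GRing.isLinear.Build R _ _ _ (@tensor R X Y x) (tensor_linear_r x)).
have [xN0 _] := norming_pair_neq0 (And3 x1 y1 xyT).
have phi_le v : `|v| <= 1 -> (adjoint (adjoint T) x v : R) <= `|T|.
  by move=> v1; exact: pairing_le.
have f_inj v : f v = 0 -> v = 0 by move=> /tensor_eq0[].
have f_span v : face (adjoint (adjoint T) x) `|T| v -> lin_span (range e) (f v).
  by move=> [v1 vT]; apply: eP; exists x, v; split.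
have yF := @face_minkowski _ _ _ (adjoint (adjoint T) x) _ f n e y
  (conj y1 xyT) phi_le f_inj f_span.
rewrite -[tensor x y]/(f y).
apply: (convex_comb_linear (f := f) _ yF) => p [[p1 pT] pE].
by exists x, p; split.
Qed.

Lemma orth_decomposition (A : set (dual (dual X))) (B : set (dual Y)) :
  (forall w, norming_tensors T setT setT w -> convex_comb (norming_tensors T A B) w) ->
  BJ_orth_set T (operators_into X Z) ->
  exists n (t : 'I_n -> R) (x : 'I_n -> dual (dual X)) (y : 'I_n -> dual Y),
    [/\ weights t, forall i, A (x i), forall i, B (y i),
      forall i, norming_pair T (x i) (y i) &
      forall (g : dual X) z, (Z : set Y) z ->
        \sum_i t i * ((y i z : R) * (x i g : R)) = 0].
Proof.
move=> AB /(orth_convex_comb T_compact T_multi_smooth)[w [m [s [q [sw qE ->]]]] w0].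
have : convex_comb (norming_tensors T A B) (\sum_i s i *: q i).
  by apply: convex_comb_idem; exists m, s, q; split=> // i; exact: AB.
move=> [n [t [p [tw pE wE]]]].
have /choice[xy xyP] i : exists xy : dual (dual X) * dual Y,
    [/\ A xy.1, B xy.2, norming_pair T xy.1 xy.2 & p i = tensor xy.1 xy.2].
  by have [x [y xyP]] := pE i; exists (x, y).
exists n, t, (fun i => (xy i).1), (fun i => (xy i).2).
split=> // [i|i|i|g z Zz]; [by case: (xyP i)|by case: (xyP i)|by case: (xyP i)|].
have := w0 g z Zz; rewrite wE dual_sumE => e; rewrite -[RHS]e; apply: eq_bigr => i _.
by case: (xyP i) => _ _ _ ->; rewrite -pairing_rank1.
Qed.

End ExtremeRepresentation.

(** * Linear relations between extreme points *)

Section Grouping.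
Context {R : realType} (V : normedModType R).

(** A linear relation between extreme points splits into its parts supported on
    the pairs v, - v. The signs s of the part that contains v i0 do not depend on
    the coefficients a, because the lemma serves for families of relations. *)
Lemma L1_property_grouping n (v : 'I_n -> V) (i0 : 'I_n) : L1_property V ->
  (forall i, extreme_point (unit_ball V) (v i)) ->
  exists s : 'I_n -> R, [/\ s i0 = 1,
    forall i, s i = 0 \/ (`|s i| = 1 /\ v i0 = s i *: v i) &
    forall a : 'I_n -> R, \sum_i a i *: v i = 0 -> \sum_i s i * a i = 0].
Proof.
move=> VL vE; pose same i j := (v i == v j) || (v i == - v j).
have same_refl i : same i i by rewrite /same eqxx.
have same_sym i j : same i j = same j i.
  by rewrite /same [v j == v i]eq_sym [v j == - v i]eq_sym eqr_oppLR.
have same_trans i j k : same i j -> same j k -> same i k.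
  by rewrite /same => /orP[]/eqP-> /orP[]/eqP->; rewrite ?opprK eqxx ?orbT.
pose rep i := odflt i [pick j | same i j].
have same_rep i : same i (rep i).
  by rewrite /rep; case: pickP => //= /(_ i); rewrite same_refl.
have repP i j : same i j -> rep i = rep j.
  move=> ij; rewrite /rep (eq_pick (_ : same i =1 same j)).
    by case: pickP => //= /(_ j); rewrite same_refl.
  move=> k; apply/idP/idP; last exact: same_trans.
  by apply: same_trans; rewrite same_sym.
have rep_rep i : rep (rep i) = rep i by apply/esym/repP.
pose s i : R := if v i == v (rep i) then 1 else -1.
have sv i : v i = s i *: v (rep i).
  have := same_rep i; rewrite /same /s; case: eqP => [->|_ /eqP ->].
    by rewrite scale1r.
  by rewrite scaleN1r.
have s2 i : s i * s i = 1 by rewrite /s; case: ifP; rewrite ?mulr1// mulrNN mulr1.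
have s1 i : `|s i| = 1 by rewrite /s; case: ifP; rewrite ?normrN normr1.
have rv i : v (rep i) = s i *: v i by rewrite [in RHS]sv scalerA s2 scale1r.
exists (fun i => if rep i == rep i0 then s i0 * s i else 0); split.
- by rewrite eqxx s2.
- move=> i; case: eqP => [e|]; [right|by left].
  by rewrite normrM !s1 mulr1 -scalerA -rv e -sv.
move=> a av; pose A := [pred j | rep j == j].
pose b j := \sum_(i | rep i == j) a i * s i.
have : \sum_(j in A) b j *: v j = 0.
  rewrite -[RHS]av [RHS](partition_big rep (mem A))/=; last first.
    by move=> i _; rewrite inE rep_rep.
  apply: eq_bigr => j _; rewrite scaler_suml; apply: eq_bigr => i /eqP <-.
  by rewrite -scalerA -sv.
rewrite big_enum_val => bv0.
have rep0A : rep i0 \in A by rewrite inE rep_rep.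
have := VL #|A| (fun k => v (enum_val k)) (fun k => vE _) _ _ bv0.
move=> /(_ _ (enum_rank_in rep0A (rep i0))); rewrite enum_rankK_in// => b0.
have {}b0 : b (rep i0) = 0.
  apply: b0 => k l kl; suff nsame : ~~ same (enum_val k) (enum_val l).
    by move: nsame; rewrite negb_or => /andP[/eqP ? /eqP ?].
  apply: contra kl => /repP; have := enum_valP k; have := enum_valP l.
  by rewrite !inE => /eqP -> /eqP -> /enum_val_inj ->.
transitivity (s i0 * b (rep i0)); last by rewrite b0 mulr0.
rewrite mulr_sumr [RHS]big_mkcond/=; apply: eq_bigr => i _.
by case: ifP => _; rewrite ?mul0r// -mulrA [s i * _]mulrC.
Qed.

Lemma extreme_norm1 (v u : V) : v != 0 ->
  extreme_point (unit_ball V) u -> `|u| = 1.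
Proof.
move=> v0 [u1 uext]; have vgt0 : 0 < `|v| by rewrite normr_gt0.
have nv : `| `|v|^-1 *: v| = 1 by rewrite normrZ normfV normr_id mulVf ?gt_eqF.
have [u0|u0] := eqVneq u 0.
  have [||||e _] := uext (`|v|^-1 *: v) (- (`|v|^-1 *: v)) 2^-1.
  - by rewrite /unit_ball/= nv.
  - by rewrite /unit_ball/= normrN nv.
  - by rewrite invr_gt0 ltr0n invf_lt1// ltr1n.
  - by rewrite u0 (_ : 1 - 2^-1 = 2^-1) ?scalerN ?subrr//; field.
  by move: nv; rewrite e u0 normr0 => /esym/eqP; rewrite oner_eq0.
apply/eqP; rewrite eq_le u1/= leNgt; apply/negP => ult1.
have ugt0 : 0 < `|u| by rewrite normr_gt0.
have [||||_ e] := uext (`|u|^-1 *: u) 0 `|u|.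
- by rewrite /unit_ball/= normrZ normfV normr_id mulVf ?gt_eqF.
- by rewrite /unit_ball/= normr0.
- by rewrite ugt0.
- by rewrite scaler0 addr0 scalerA divff ?gt_eqF// scale1r.
by rewrite -e eqxx in u0.
Qed.

(** Otherwise u would be a proper convex combination of P u and u - P u, rescaled
    to the norm of u. *)
Lemma Lproj_extreme (P : {linear V -> V}) u : (forall v, P (P v) = P v) ->
  (forall v, `|v| = `|P v| + `|v - P v|) ->
  extreme_point (unit_ball V) u -> P u = 0 \/ P u = u.
Proof.
move=> PP Pn [u1 uext]; have [->|Pu0] := eqVneq (P u) 0; first by left.
have [/eqP|Qu0] := eqVneq (u - P u) 0.
  by rewrite subr_eq0 => /eqP <-; right.
left; have a0 : 0 < `|P u| by rewrite normr_gt0.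
have b0 : 0 < `|u - P u| by rewrite normr_gt0.
have c0 : 0 < `|u| by rewrite Pn addr_gt0.
have t01 : 0 < `|P u| / `|u| < 1.
  by rewrite divr_gt0//= ltr_pdivrMr// mul1r [ltRHS]Pn ltrDl.
have tE : 1 - `|P u| / `|u| = `|u - P u| / `|u|.
  rewrite -{1}(divff (lt0r_neq0 c0)) -mulrBl; congr (_ * _).
  by rewrite [X in X - _]Pn addrC addKr.
have [|||h _] := uext ((`|u| / `|P u|) *: P u)
  ((`|u| / `|u - P u|) *: (u - P u)) _ _ _ t01.
- by rewrite /unit_ball/= normrZ normrM normfV !normr_id divfK ?gt_eqF.
- by rewrite /unit_ball/= normrZ normrM normfV !normr_id divfK ?gt_eqF.
- rewrite tE !scalerA !mulrA divfK ?gt_eqF// divff ?gt_eqF//.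
  by rewrite divfK ?gt_eqF// divff ?gt_eqF// !scale1r addrC subrK.
have := congr1 P h; rewrite linearZ/= PP h => e.
by rewrite -e subrr eqxx in Qu0.
Qed.

End Grouping.

Lemma L1_property_isometry {R : realType} (V W : normedModType R) :
  isometrically_isomorphic V W -> L1_property W -> L1_property V.
Proof.
move=> [f [h hf fh] fn] WL n v vE vN a av.
have hn w : `|h w| = `|w| by rewrite -fn fh.
have hZ b x : h (b *: x) = b *: h x.
  by apply: (can_inj hf); rewrite linearZ/= !fh.
have hlin : linear h by move=> b x y; apply: (can_inj hf); rewrite linearP !fh.
apply: (WL n (fun i => f (v i))) => [i|i j /vN[vij vNij]|].
- have [v1 vext] := vE i; split; first by rewrite /unit_ball/= fn.
  move=> y z t y1 z1 t01 e.
  have [||||hy hz] := vext (h y) (h z) t.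
  + by rewrite /unit_ball/= hn.
  + by rewrite /unit_ball/= hn.
  + by [].
  + by rewrite -[LHS]hf e hlin hZ.
  by rewrite -[y]fh -[z]fh hy hz.
- by split=> [/(can_inj hf)|] //; rewrite -linearN => /(can_inj hf).
rewrite -[RHS](linear0 f) -av linear_sum; apply: eq_bigr => i _.
by rewrite linearZ.
Qed.

(** * Extreme points of the unit ball of L1 *)

Section BandProjections.
Context d (T : measurableType d) {R : realType} (mu : {measure set T -> \bar R}).
Local Notation Lfun1 := (LfunType mu (@lexx _ _ 1%E)).
Implicit Types (A : set T) (f g : Lfun1) (u v : L1 mu).

Lemma Lfun1_int f : mu.-integrable setT (EFin \o f).
Proof. by apply/Lfun1_integrable; exact: LfunP. Qed.

Lemma bounded_mul_in (s : T -> R) (f : T -> R) : measurable_fun setT s ->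
  (forall x, `|s x| <= 1) -> mu.-integrable setT (EFin \o f) ->
  mu.-integrable setT (EFin \o (fun x => s x * f x)).
Proof.
move=> ms s1 fi; have mf := measurable_int mu fi.
apply: (le_integrable _ _ _ fi) => //.
  apply/measurable_EFinP; apply: measurable_funM => //.
  exact/measurable_EFinP.
by move=> x _ /=; rewrite lee_fin normrM ler_piMl.
Qed.

Lemma indic_le1 A (x : T) : `|\1_A x : R| <= 1.
Proof. by rewrite indicE; case: (_ \in _); rewrite ?normr1 ?normr0 ?ler01. Qed.

Lemma indic_pred (P : pred T) x : \1_[set y | P y] x = (P x)%:R :> R.
Proof. by rewrite indicE; congr ((nat_of_bool _)%:R); apply/idP/idP; rewrite inE. Qed.

Lemma cut_in A (mA : measurable A) f : (fun x => \1_A x * f x) \in Lfun mu 1.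
Proof.
apply/Lfun1_integrable/bounded_mul_in; last exact: Lfun1_int.
- exact: measurable_indic.
- exact: indic_le1.
Qed.

Definition cut A (mA : measurable A) f : Lfun1 :=
  Lfun_Sub (@lexx _ _ 1%E) (cut_in mA f).

Lemma cutE A (mA : measurable A) f x : cut mA f x = \1_A x * f x.
Proof. by []. Qed.

Definition band A (mA : measurable A) u : L1 mu := L1_class (cut mA (L1_repr u)).

Lemma bandE A (mA : measurable A) f : band mA (L1_class f) = L1_class (cut mA f).
Proof.
apply/L1_classP; apply: filterS (L1_pi_ae f) => x fx _.
by rewrite !cutE; congr (_ * _); exact: fx.
Qed.

Lemma L1_linE a f g : a *: (L1_class f : L1 mu) + L1_class g = L1_class (a *: f + g).
Proof. by rewrite [_ *: _]L1_scaleE [_ + _]L1_addE. Qed.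

Lemma band_linear A (mA : measurable A) : linear (band mA).
Proof.
move=> a; elim/L1_class_ind => f; elim/L1_class_ind => g.
rewrite L1_linE !bandE L1_linE; apply/L1_classP; apply: aeW => x _.
rewrite cutE -[(a *: f + g) x]/(a * f x + g x).
rewrite -[RHS]/(a * (\1_A x * f x) + \1_A x * g x); ring.
Qed.

HB.instance Definition _ A (mA : measurable A) :=
  GRing.isLinear.Build R (L1 mu) (L1 mu) _ (band mA) (band_linear mA).

Lemma band_idem A (mA : measurable A) u : band mA (band mA u) = band mA u.
Proof.
elim/L1_class_ind: u => f; rewrite !bandE; apply/L1_classP; apply: aeW => x _.
by rewrite !cutE mulrA indicE; case: (_ \in _); rewrite ?mul1r ?mul0r.
Qed.

Lemma L1_class_norm f : `|L1_class f : L1 mu| = \int[mu]_x `|f x|.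
Proof. by rewrite -[LHS]/(L1_norm _) L1_normE Lnorm1. Qed.

Lemma band_norm A (mA : measurable A) u : `|u| = `|band mA u| + `|u - band mA u|.
Proof.
elim/L1_class_ind: u => f; rewrite bandE.
have -> : (L1_class f : L1 mu) - L1_class (cut mA f) = L1_class (f - cut mA f).
  by rewrite [- _]L1_oppE [_ + _]L1_addE.
have abs_int g : mu.-integrable setT (EFin \o (fun x => `|g x|)).
  exact: (integrable_abse (Lfun1_int g)).
rewrite !L1_class_norm -RintegralD//; apply: eq_Rintegral => x _.
rewrite -[(f - cut mA f) x]/(f x - \1_A x * f x) cutE indicE.
by case: (_ \in _); rewrite ?mul1r ?mul0r ?subrr ?subr0 ?normr0 ?addr0 ?add0r.
Qed.

Lemma support_measurable f : measurable [set x | f x != 0].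
Proof.
have mf : measurable_fun setT f by apply/measurable_EFinP/(measurable_int mu)/Lfun1_int.
rewrite (_ : [set _ | _] = setT `&` f @^-1` ~` [set 0]).
  by apply: mf => //; exact: measurableC.
by apply/seteqP; split=> x /=; [move=> /eqP|move=> [_ /eqP]].
Qed.

Definition support_band u v : L1 mu := band (support_measurable (L1_repr u)) v.

Lemma measurable_fun_int (h : T -> R) : mu.-integrable setT (EFin \o h) ->
  measurable_fun setT h.
Proof. by move=> /(measurable_int mu)/measurable_EFinP. Qed.

Lemma measurable_sgr f : measurable_fun setT (fun x => Num.sg (f x)).
Proof.
have mf := measurable_fun_int (Lfun1_int f).
have mP : measurable [set x | 0 < f x].
  rewrite (_ : [set _ | _] = setT `&` f @^-1` `]0, +oo[%classic); first exact: mf.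
  by rewrite setTI; apply/seteqP; split=> x /=; rewrite in_itv/= andbT.
have mN : measurable [set x | f x < 0].
  rewrite (_ : [set _ | _] = setT `&` f @^-1` `]-oo, 0[%classic); first exact: mf.
  by rewrite setTI; apply/seteqP; split=> x /=; rewrite in_itv/=.
rewrite (_ : (fun x => _) = \1_[set x | 0 < f x] \- (\1_[set x | f x < 0] : T -> R)).
  by apply: measurable_funB; exact: measurable_indic.
apply/funext => x /=; rewrite !indic_pred.
case: (ltgtP 0 (f x)) => [fx|fx|<-].
- by rewrite gtr0_sg// subr0.
- by rewrite ltr0_sg// sub0r.
- by rewrite sgr0 subrr.
Qed.

Lemma ae_eq0_Rintegral (h : T -> R) : mu.-integrable setT (EFin \o h) ->
  \int[mu]_x `|h x| = 0 -> h = cst 0 %[ae mu].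
Proof.
move=> hi h0; have mh := measurable_int mu hi.
have hfin : (\int[mu]_x `|(h x)%:E|)%E \is a fin_num.
  exact: integrable_fin_num (integrable_abse hi).
have : (\int[mu]_x `|(h x)%:E| = 0)%E.
  by rewrite -(fineK hfin) -[X in _ = X%:E]h0.
move=> /(ae_eq_integral_abs mu measurableT mh); apply: filterS => x + xT.
by move=> /(_ xT) [].
Qed.

Lemma ae_const_sign (h : T -> R) : mu.-integrable setT (EFin \o h) ->
  \int[mu]_x h x = 0 -> (\forall x \ae mu, 0 <= h x) -> h = cst 0 %[ae mu].
Proof.
move=> hi h0 hge; apply: ae_eq0_Rintegral => //; rewrite -[RHS]h0.
congr fine; apply: ae_eq_integral => //.
- exact: measurable_int (integrable_abse hi).
- exact: measurable_int hi.
by apply: filterS hge => x hx _ /=; rewrite ger0_norm.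
Qed.

(** Let c be such that (w - c u) sg u has integral 0. The band of the set where
    this function is positive fixes or kills u, so the function has constant sign
    and therefore vanishes almost everywhere. *)
Lemma extreme_proportional u w : extreme_point (unit_ball (L1 mu)) u ->
  exists c : R, support_band u w = c *: u.
Proof.
move=> uext; pose f := L1_repr u; pose g := L1_repr w.
pose c := (\int[mu]_x (Num.sg (f x) * g x)) / (\int[mu]_x `|f x|).
pose h x := Num.sg (f x) * (g x - c * f x).
have sg1 x : `|Num.sg (f x)| <= 1.
  by rewrite normr_sg; case: eqP; rewrite ?ler01 ?lexx.
have sgi (k : Lfun1) : mu.-integrable setT (EFin \o (fun x => Num.sg (f x) * k x)).
  by apply: bounded_mul_in; [exact: measurable_sgr|exact: sg1|exact: Lfun1_int].
have hi : mu.-integrable setT (EFin \o h) by exact: (sgi (g - c *: f)).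
suff h0 : h = cst 0 %[ae mu].
  exists c; rewrite -{2}[u]L1_reprK [RHS]L1_scaleE; apply/L1_classP.
  apply: filterS h0 => x + xT => /(_ xT) hx.
  rewrite -[LHS]/(\1_[set y | f y != 0] x * g x) indic_pred -[RHS]/(c * f x).
  have {}hx : Num.sg (f x) * (g x - c * f x) = 0 := hx.
  move: hx; have [->|fx] := eqVneq (f x) 0; first by rewrite mul0r mulr0.
  move=> /eqP; rewrite mulf_eq0 sgr_eq0 (negbTE fx)/= subr_eq0 => /eqP.
  by rewrite mul1r.
have [f0|f0] := eqVneq (\int[mu]_x `|f x|) 0.
  have := ae_eq0_Rintegral (Lfun1_int f) f0; apply: filterS => x + xT => /(_ xT) fx.
  by rewrite /h (_ : f x = 0) ?sgr0 ?mul0r.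
have inth : \int[mu]_x h x = 0.
  transitivity (\int[mu]_x (Num.sg (f x) * g x - c * `|f x|)).
    by apply: eq_Rintegral => x _; rewrite /h mulrBr mulrCA -normrEsg.
  have fi : mu.-integrable setT (EFin \o (fun x => `|f x|)).
    exact: (integrable_abse (Lfun1_int f)).
  rewrite RintegralB//; last first.
    by have := integrableZl measurableT c fi.
  by rewrite RintegralZl// /c divfK// subrr.
have mh := measurable_fun_int hi.
have mA : measurable [set x | 0 < h x].
  rewrite (_ : [set _ | _] = setT `&` h @^-1` `]0, +oo[%classic); first exact: mh.
  by rewrite setTI; apply/seteqP; split=> x /=; rewrite in_itv/= andbT.
have := Lproj_extreme (P := band mA) (band_idem mA) (band_norm mA) uext.
rewrite -{1 2 3}[u]L1_reprK /= bandE => -[]/L1_classP uA.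
  have hN0 : (fun x => - h x) = cst 0 %[ae mu].
    apply: ae_const_sign.
    - by have := integrableN hi.
    - have -> : \int[mu]_x (- h x) = \int[mu]_x (-1 * h x).
        by apply: eq_Rintegral => x _; rewrite mulN1r.
      by rewrite RintegralZl// inth mulr0.
    apply: filterS uA => x /(_ I); rewrite cutE indic_pred oppr_ge0.
    case: ltP => // hx; rewrite mul1r => fx.
    by move: hx; rewrite /h (_ : f x = 0) ?sgr0 ?mul0r ?ltxx.
  apply: filterS hN0 => x + xT => /(_ xT) /eqP; rewrite oppr_eq0 => /eqP.
  by [].
apply: ae_const_sign => //.
apply: filterS uA => x /(_ I); rewrite cutE indic_pred.
case: ltP => [/ltW//|hx]; rewrite mul0r => fx.
by rewrite /h (_ : f x = 0) ?sgr0 ?mul0r.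
Qed.

Lemma support_band_id u : support_band u u = u.
Proof.
rewrite -[RHS]L1_reprK; apply/L1_classP; apply: aeW => x _.
rewrite cutE indic_pred.
by case: eqP => [->|_]; rewrite ?mul1r ?mulr0.
Qed.

(** For distinct i and j the extreme point u i is killed by the support band of
    u j: otherwise it would be proportional to u j, hence equal to u j or - u j.
    The zero space is excluded, since its only point 0 is extreme in the ball. *)
Lemma L1_has_L1_property v : v != 0 -> L1_property (L1 mu).
Proof.
move=> v0 n u uext uN a au j.
have u1 i := extreme_norm1 v0 (uext i).
have disjoint i : i != j -> support_band (u j) (u i) = 0.
  move=> ij; have [c ec] := extreme_proportional (u i) (uext j).
  have [//|e] := Lproj_extreme (P := band (support_measurable (L1_repr (u j))))
    (band_idem _) (band_norm _) (uext i).
  have uc : u i = c *: u j by rewrite -ec.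
  have c1 : `|c| = 1 by have := u1 i; rewrite uc normrZ u1 mulr1.
  have [uij uNij] := uN i j ij; exfalso.
  have [c0|c0] := leP 0 c.
    by apply: uij; rewrite uc -(ger0_norm c0) c1 scale1r.
  by apply: uNij; rewrite uc -[c]opprK -(ltr0_norm c0) c1 scaleN1r.
have := congr1 (band (support_measurable (L1_repr (u j)))) au.
rewrite linear_sum linear0 (bigD1 j)//= big1 => [|i ij].
  rewrite addr0 linearZ/= -[band _ _]/(support_band (u j) (u j)) support_band_id.
  move=> /eqP; rewrite scaler_eq0 => /orP[/eqP//|/eqP uj0].
  by have := u1 j; rewrite uj0 normr0 => /esym/eqP; rewrite oner_eq0.
by rewrite linearZ/= -[band _ _]/(support_band (u j) (u i)) disjoint// scaler0.
Qed.

End BandProjections.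

(** * Restriction to an M-ideal *)

Section Restriction.
Context {R : realType} (Y : normedModType R) (Z : closedSubspace Y).

Lemma restriction_bounded (f : dual Y) :
  (fun z : csub Z => f (val z)) \in bounded_linear (csub Z) R^o.
Proof.
rewrite inE; split=> [a x y|]; first exact: (linearP f a (val x) (val y)).
by exists `|f| => z; exact: (dual_bound f (val z)).
Qed.

Definition restriction (f : dual Y) : dual (csub Z) := Bop (restriction_bounded f).

Lemma restriction_linear : linear restriction.
Proof. by move=> a f g; apply/val_inj/funext. Qed.

HB.instance Definition _ :=
  GRing.isLinear.Build R (dual Y) (dual (csub Z)) _ restriction restriction_linear.

Lemma restriction_norm_le (f : dual Y) : `|restriction f| <= `|f|.
Proof. by apply: opnorm_leM => // z; exact: (dual_bound f (val z)). Qed.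

Lemma restriction_eq0 (f : dual Y) : restriction f = 0 <-> annihilator Z f.
Proof.
split=> [f0 z Zz|f0].
  have zZ : z \in csub_pred Z by rewrite inE.
  by have := congr1 (fun h : dual (csub Z) => h (exist _ z zZ)) f0.
apply/val_inj/funext => z; apply: f0.
by have := valP z; rewrite inE.
Qed.

Lemma extension_restriction (h : dual (csub Z)) :
  exists g : dual Y, `|g| <= `|h| /\ restriction g = h.
Proof.
have [g [gh gE]] := dual_extension h; exists g; split=> //.
exact/val_inj/funext.
Qed.

Section MIdeal.
Context (P : {linear dual Y -> dual Y}).
Hypotheses (P_idem : forall f, P (P f) = P f)
  (P_ker : [set f | P f = 0] = annihilator Z)
  (P_norm : forall f, `|f| = `|P f| + `|f - P f|).

Lemma P_contraction f : `|P f| <= `|f|.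
Proof. by rewrite [leRHS]P_norm lerDl. Qed.

Lemma P_eq f g : restriction f = restriction g -> P f = P g.
Proof.
move=> fg; apply/eqP; rewrite -subr_eq0 -linearB; apply/eqP.
suff : annihilator Z (f - g) by rewrite -P_ker.
by apply/restriction_eq0; rewrite linearB/= fg subrr.
Qed.

Lemma restriction_P f : restriction (P f) = restriction f.
Proof.
apply/eqP; rewrite -subr_eq0 -linearB; apply/eqP/restriction_eq0.
by rewrite -P_ker /= linearB P_idem subrr.
Qed.

Lemma restriction_inj f g : P f = f -> P g = g ->
  restriction f = restriction g -> f = g.
Proof. by move=> <- <- /P_eq; rewrite !P_idem. Qed.

(** On the range of P, restriction to Z is a surjective isometry onto the dual
    of Z. *)
Lemma restriction_extreme f : P f = f ->
  extreme_point (unit_ball (dual Y)) f ->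
  extreme_point (unit_ball (dual (csub Z))) (restriction f).
Proof.
move=> Pf [f1 fext]; split; first exact: le_trans (restriction_norm_le f) f1.
move=> a b t a1 b1 t01 e.
have [a' [a'a a'E]] := extension_restriction a.
have [b' [b'b b'E]] := extension_restriction b.
have [||||fa fb] := fext (P a') (P b') t.
- exact: le_trans (P_contraction _) (le_trans a'a a1).
- exact: le_trans (P_contraction _) (le_trans b'b b1).
- by [].
- rewrite -linearZ -[X in _ + X]linearZ -linearD -[LHS]Pf; apply: P_eq.
  by rewrite e linearD !linearZ/= a'E b'E.
by split; [rewrite -fa|rewrite -fb]; rewrite restriction_P ?a'E ?b'E.
Qed.

End MIdeal.

End Restriction.

(** * The equivalences *)

Section Equivalences.
Context {R : realType} (X Y : normedModType R) (Z : closedSubspace Y) (T : bop X Y).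

Let Tadj2 : bop (dual (dual X)) (dual (dual Y)) := adjoint (adjoint T).
Let Zperp2 : set (dual (dual Y)) := annihilator (annihilator Z).

Lemma norm_adjoint2 (S : bop X Y) : `|adjoint (adjoint S)| = `|S|.
Proof.
apply/eqP; rewrite eq_le (le_trans (adjoint_norm_le _) (adjoint_norm_le _))/=.
apply/ler_addgt0Pr => e e0; have [x [y [x1 y1 /ltW]]] := near_norming_pair S e0.
rewrite lerBlDr => /le_trans; apply; rewrite lerD2r.
rewrite -[leLHS]/((adjoint (adjoint S) x) y : R) -[leRHS]mulr1; apply: dual_le => //.
rewrite (le_trans (opnorm_bound _ _))// ler_piMr//.
Qed.

(** If w is in the bipolar of Z then T^** x + l w takes the value |T| at y, for
    every l. *)
Lemma norming_pair_orth_bipolar x y : T <> 0 -> norming_pair T x y ->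
  annihilator Z y -> norm_attaining Tadj2 x /\ BJ_orth_set (Tadj2 x) Zperp2.
Proof.
move=> T0 [x1 y1 xyT] yZ; have Tgt0 : 0 < `|T| by rewrite normr_gt0; exact/eqP.
have T_le : `|T| <= `|Tadj2 x|.
  by rewrite -xyT -[leRHS]mulr1; exact: (dual_le (lexx `|Tadj2 x|) y1).
have Tx_le : `|Tadj2 x| <= `|T| * `|x|.
  by rewrite -(norm_adjoint2 T); exact: opnorm_bound.
have x_eq1 : `|x| = 1.
  apply/eqP; rewrite eq_le x1/= -(ler_pM2l Tgt0) mulr1.
  exact: le_trans T_le Tx_le.
have TxT : `|Tadj2 x| = `|T|.
  by apply/eqP; rewrite eq_le T_le andbT (le_trans Tx_le)// x_eq1 mulr1.
split; first by split=> //; rewrite TxT norm_adjoint2.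
move=> w wZ l; rewrite TxT -xyT -[leRHS]mulr1.
have -> : pairing T x y = (Tadj2 x + l *: w) y.
  rewrite -[RHS]/((Tadj2 x y : R) + l * (w y : R)).
  by rewrite (wZ y yZ) mulr0 addr0.
exact: dual_le.
Qed.

Lemma attaining_orth x : norm_attaining Tadj2 x -> BJ_orth_set (Tadj2 x) Zperp2 ->
  BJ_orth_set Tadj2 (operators_into (dual (dual X)) Zperp2).
Proof.
move=> [x1 xT] xZ S SZ l; rewrite -xT (le_trans (xZ _ (SZ x) l))//.
rewrite -[Tadj2 x + _]/((Tadj2 + l *: S) x) (le_trans (opnorm_bound _ _))//.
by rewrite x1 mulr1.
Qed.

Lemma orth_adjoint2 :
  BJ_orth_set Tadj2 (operators_into (dual (dual X)) Zperp2) ->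
  BJ_orth_set T (operators_into X Z).
Proof.
move=> TZ S SZ l; rewrite -(norm_adjoint2 T) -(norm_adjoint2 (T + _)).
have -> : adjoint (adjoint (T + l *: S)) = Tadj2 + l *: adjoint (adjoint S).
  by rewrite addrC adjoint_linear adjoint_linear addrC.
apply: TZ => x g gZ /=; have -> : adjoint_fun S g = 0.
  by apply/val_inj/funext => v; apply: gZ; exact: SZ.
exact: linear0.
Qed.

Lemma pairingZl a (x : dual (dual X)) (y : dual Y) :
  pairing T (a *: x) y = a * pairing T x y.
Proof. by []. Qed.

Lemma pairingZr a (x : dual (dual X)) (y : dual Y) :
  pairing T x (a *: y) = a * pairing T x y.
Proof. by rewrite /pairing linearZ/= linearZ. Qed.

Lemma pairing_suml n (c : 'I_n -> R) (x : 'I_n -> dual (dual X)) y :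
  pairing T (\sum_i c i *: x i) y = \sum_i c i * pairing T (x i) y.
Proof. exact: dual_sumE. Qed.

Lemma pairing_sumr n (c : 'I_n -> R) x (y : 'I_n -> dual Y) :
  pairing T x (\sum_i c i *: y i) = \sum_i c i * pairing T x (y i).
Proof.
rewrite -[LHS]/(adjoint (adjoint T) x (\sum_i c i *: y i)) linear_sum.
by apply: eq_bigr => i _; rewrite linearZ.
Qed.

Lemma group_weight_gt0 n (s t : 'I_n -> R) i0 : (forall i, 0 <= t i) ->
  s i0 = 1 -> 0 < t i0 -> 0 < \sum_i `|s i| * t i.
Proof.
move=> t0 si0 ti0; rewrite (bigD1 i0)//= si0 normr1 mul1r ltr_pwDl//.
by rewrite sumr_ge0// => i _; rewrite mulr_ge0.
Qed.

Lemma exists_pos_weight n (t : 'I_n -> R) : weights t -> exists i, 0 < t i.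
Proof.
move=> [t0 t1]; apply/existsP; apply: contraT => /existsPn tN.
have : \sum_i t i = 0.
  by apply: big1 => i _; apply/eqP; rewrite eq_le t0 andbT leNgt tN.
by move/eqP; rewrite t1 oner_eq0.
Qed.

Hypotheses (T_compact : compact_operator T) (T_multi_smooth : multi_smooth_finite T).

(** In a convex combination of norming tensors that vanishes on the operators of
    rank one into Z, group the terms by their left factors up to sign: the signed
    mean of the right factors of a group annihilates Z and still norms T. *)
Lemma orth_extreme : L1_property (dual (dual X)) ->
  BJ_orth_set T (operators_into X Z) ->
  exists x y, [/\ extreme_point (unit_ball (dual (dual X))) x,
    norming_pair T x y & annihilator Z y].
Proof.
move=> XL /(orth_decomposition T_compact T_multi_smooth
  (norming_tensors_extreme_l T_multi_smooth)).
move=> [n [t [x [y [tw xext _ xyT xy0]]]]]; have [t0 _] := tw.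
have [i0 ti0] := exists_pos_weight tw.
have [s [si0 s1 s_sum]] := L1_property_grouping i0 XL xext.
pose tau := \sum_i `|s i| * t i.
have tau0 : 0 < tau by exact: (group_weight_gt0 t0 si0 ti0).
pose y' := \sum_i (s i * t i) *: y i.
have y'Z : annihilator Z y'.
  move=> z Zz; rewrite -[LHS]/((y' z : R)) /y' dual_sumE.
  have := s_sum (fun i => t i * (y i z : R)) => h.
  rewrite -[RHS]h; first by apply: eq_bigr => i _; rewrite mulrA.
  apply: dual_eq0 => g; rewrite dual_sumE -[RHS](xy0 g z Zz).
  by apply: eq_bigr => i _; rewrite mulrA.
have y'_norm : `|y'| <= tau.
  rewrite (le_trans (ler_norm_sum _ _ _))//; apply: ler_sum => i _.
  rewrite normrZ normrM (ger0_norm (t0 i)) ler_piMr ?mulr_ge0//.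
  by case: (xyT i).
have y'_pair : pairing T (x i0) y' = tau * `|T|.
  rewrite pairing_sumr mulr_suml; apply: eq_bigr => i _.
  have [->|[si xi0]] := s1 i; first by rewrite normr0 !mul0r.
  have [_ _ xyi] := xyT i; have ss : s i * s i = 1.
    by rewrite -expr2 -real_normK ?num_real// si expr1n.
  by rewrite xi0 pairingZl xyi si mul1r mulrACA ss mul1r.
exists (x i0), (tau^-1 *: y'); split=> //.
- split; first by case: (xyT i0).
  + by rewrite normrZ gtr0_norm ?invr_gt0// ler_pdivrMl// mulr1.
  + by rewrite pairingZr y'_pair mulKf ?gt_eqF.
- move=> z Zz; rewrite -[LHS]/(tau^-1 * (y' z : R)) (y'Z z Zz); exact: mulr0.
Qed.

(** By Lproj_extreme an extreme right factor annihilates Z or lies in the range of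
    P. If all lay in the range, their restrictions would be extreme in the ball
    of the dual of Z, an L1-space; grouping by them, the signed mean x' of the
    left factors of a group is 0, although x' (T^* y) > 0 for a right factor y of
    this group. *)
Lemma orth_M_ideal : L1_predual (csub Z) -> M_ideal Z ->
  BJ_orth_set T (operators_into X Z) ->
  exists x y, norming_pair T x y /\ annihilator Z y.
Proof.
move=> [d [S [mu ZL]]] [P [P_idem P_ker P_norm]].
move=> /(orth_decomposition T_compact T_multi_smooth
  (norming_tensors_extreme_r T_multi_smooth)).
move=> [n [t [x [y [tw _ yext xyT xy0]]]]]; have [t0 _] := tw.
have [[i yiZ]|yN] := pselect (exists i, annihilator Z (y i)).
  by exists (x i), (y i).
exfalso; have Py i : P (y i) = y i.
  have [e|//] := Lproj_extreme P_idem P_norm (yext i).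
  by exfalso; apply: yN; exists i; rewrite -P_ker.
have [i0 ti0] := exists_pos_weight tw.
pose eta i := restriction Z (y i).
have etaext i : extreme_point (unit_ball (dual (csub Z))) (eta i).
  exact: (restriction_extreme P_idem P_ker P_norm (Py i) (yext i)).
have eta0 : eta i0 <> 0.
  by move=> /restriction_eq0 h; apply: yN; exists i0.
have ZLp : L1_property (dual (csub Z)).
  have [f fbij fn] := ZL; apply: L1_property_isometry; first by exists f.
  apply: (L1_has_L1_property (v := f (eta i0))).
  by rewrite -normr_eq0 fn normr_eq0; exact/eqP.
have [s [si0 s1 s_sum]] := L1_property_grouping i0 ZLp etaext.
have eta_y i : eta i0 = s i *: eta i -> y i0 = s i *: y i.
  move=> e; apply: (restriction_inj P_idem P_ker) => //.
    by rewrite linearZ/= Py.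
  by rewrite linearZ.
pose x' := \sum_i (s i * t i) *: x i.
have x'0 : x' = 0.
  apply: dual_eq0 => g; rewrite dual_sumE.
  have := s_sum (fun i => t i * (x i g : R)) => h.
  rewrite -[RHS]h; first by apply: eq_bigr => i _; rewrite mulrA.
  apply: dual_eq0 => z; rewrite dual_sumE.
  have zZ : (Z : set Y) (val z) by have := valP z; rewrite inE.
  rewrite -[RHS](xy0 g _ zZ).
  by apply: eq_bigr => i _; rewrite -mulrA [X in _ * X]mulrC.
have tau0 := group_weight_gt0 t0 si0 ti0.
have : pairing T x' (y i0) = (\sum_i `|s i| * t i) * `|T|.
  rewrite pairing_suml mulr_suml; apply: eq_bigr => i _.
  have [->|[si etai0]] := s1 i; first by rewrite normr0 !mul0r.
  have [_ _ xyi] := xyT i; have ss : s i * s i = 1.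
    by rewrite -expr2 -real_normK ?num_real// si expr1n.
  by rewrite (eta_y _ etai0) pairingZr xyi si mul1r mulrACA ss mul1r.
rewrite x'0 -[pairing T 0 _]/0 => /esym/eqP.
have [T0 _] := T_multi_smooth.
by rewrite mulf_eq0 gt_eqF//= normr_eq0 => /eqP.
Qed.

End Equivalences.

Theorem mainTheorem4 (R : realType) (X Y : completeNormedModType R)
    (Z : closedSubspace Y) (T : bop X Y)
    (T_compact : compact_operator T) (T_multi_smooth : multi_smooth_finite T) :
  let Tadj2 : bop (dual (dual X)) (dual (dual Y)) := adjoint (adjoint T) in
  let Zperp2 : set (dual (dual Y)) := annihilator (annihilator Z) in
  (L1_predual (csub Z) -> M_ideal Z ->
    [<-> BJ_orth_set T (operators_into X Z);
         exists2 x : dual (dual X),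
           norm_attaining Tadj2 x & BJ_orth_set (Tadj2 x) Zperp2;
         BJ_orth_set Tadj2 (operators_into (dual (dual X)) Zperp2)])
  /\
  (L1_property (dual (dual X)) ->
    [<-> BJ_orth_set T (operators_into X Z);
         exists2 x : dual (dual X),
           (norm_attaining Tadj2 `&` extreme_point (unit_ball (dual (dual X)))) x
           & BJ_orth_set (Tadj2 x) Zperp2;
         BJ_orth_set Tadj2 (operators_into (dual (dual X)) Zperp2)]).
Proof.
move=> Tadj2 Zperp2; have [T0 _] := T_multi_smooth.
split=> [ZL ZM|XL]; tfae.
- move=> /(orth_M_ideal T_compact T_multi_smooth ZL ZM)[x [y [xyT yZ]]].
  by have [xT xZ] := norming_pair_orth_bipolar T0 xyT yZ; exists x.
- by move=> [x xT xZ]; exact: attaining_orth xT xZ.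
- exact: orth_adjoint2.
- move=> /(orth_extreme T_compact T_multi_smooth XL)[x [y [xext xyT yZ]]].
  by have [xT xZ] := norming_pair_orth_bipolar T0 xyT yZ; exists x.
- by move=> [x [xT _] xZ]; exact: attaining_orth xT xZ.
- exact: orth_adjoint2.
Qed.
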